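(* Consider the Best-of-three on the stochastic block model $G(2n,p,q)$, where $p=p(n)=\omega(\log n/n)$ and $r:=q/p$ is a constant. (i) If $r>\frac17$, then $G(2n,p,q)$ w.h.p. satisfies the following property: there exist two positive constants $C,C'>0$ such that for all $A\subseteq V$ with $\bigl||A|-|V\setminus A|\bigr|=\Omega(n)$, $$\Pr\left[T_{\mathrm{cons}}(A)\le C\left(\log\log n+\frac{\log n}{\log(np)}\right)\right]\ge 1-O(n^{-C'}).$$ (ii) If $r<\frac17$, then $G(2n,p,q)$ w.h.p. satisfies the following property: there exist a set $A\subseteq V$ with $\bigl||A|-|V\setminus A|\bigr|=\Omega(n)$ and two positive constants $C,C'>0$ such that $$\Pr\left[T_{\mathrm{cons}}(A)\ge \exp(Cn)\right]\ge 1-O(n^{-C'}).$$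
   Context: Stochastic block model: for $n\in\mathbb N$ and $p,q\in[0,1]$ with $q\le p$, $G(2n,p,q)$ is the random graph on $V=V_1\cup V_2$, $|V_1|=|V_2|=n$, $V_1\cap V_2=\emptyset$, in which each pair of distinct vertices $u\in V_i$, $v\in V_j$ forms an edge independently with probability $p$ if $i=j$ and $q$ if $i\ne j$. Here $p=p(n)$, $q=q(n)$. Best-of-three: each vertex of a graph $G=(V,E)$ holds an opinion in $\{1,2\}$. In each synchronous discrete step, every vertex independently samples three uniformly random neighbors (with replacement) and adopts the majority opinion among them. Thus, if $A$ is the set of vertices with opinion 1 and $A'$ the set after one step, the events $\{v\in A'\}$ ($v\in V$) are independent given $A$ and $\Pr[v\in A']=f(\deg_A(v)/\deg(v))$ with $f(x)=3x^2-2x^3$, where $\deg(v)$ is the degree of $v$ and $\deg_A(v)$ the number of neighbors of $v$ in $A$. The graph is generated first and then kept fixed; then an initial set $A^{(0)}=A$ is chosen and $A^{(t+1)}=(A^{(t)})'$. The consensus time is $T_{\mathrm{cons}}(A)=\min\{t\ge0: A^{(t)}\in\{\emptyset,V\},\ A^{(0)}=A\}$ ($\infty$ if there is no such $t$). In the displayed inequalities $\Pr$ is over the voting process on the fixed graph; ''w.h.p.'' there refers to the random graph. Asymptotics are as $n\to\infty$. ''W.h.p.'' means with probability at least $1-n^{-c}$ for some constant $c>0$. ''Constant'' means independent of $n$. A condition $\bigl||A|-|V\setminus A|\bigr|=\Omega(n)$ means $\bigl||A|-|V\setminus A|\bigr|\ge \kappa n$ for a constant $\kappa>0$; in (i) $\kappa$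 is an arbitrary fixed constant (and $C,C'$ and the hidden constants may depend on it), in (ii) such a constant $\kappa$ exists. The logarithm is natural. *)

(* Defs.v *)
From HB Require Import structures.
From mathcomp Require Import all_boot all_order all_algebra.
From mathcomp Require Import all_classical all_reals all_analysis.
From mathcomp Require Import ring.
Set Implicit Arguments.
Unset Strict Implicit.
Unset Printing Implicit Defensive.
Import Order.TTheory GRing.Theory Num.Theory.
Import numFieldNormedType.Exports.
Local Open Scope classical_set_scope.
Local Open Scope ring_scope.

(** ** The stochastic block model G(2n, p, q) *)

(** The Boolean component is the block: V_1 = {(true, i)}, V_2 = {(false, i)}. *)
Definition vertex (n : nat) : finType := (bool * 'I_n)%type.

(** A graph is given by its edge set, a subset of [vertex_pairs n]. *)
Definition vertex_pairs (n : nat) : {set {set vertex n}} :=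
  [set e : {set vertex n} | #|e| == 2%N]%SET.

Definition same_block (n : nat) (e : {set vertex n}) : bool :=
  [forall u in e, forall v in e, u.1 == v.1].

Definition edge_prob (R : realType) (n : nat) (p q : R) (e : {set vertex n}) : R :=
  if same_block e then p else q.

Definition sbm_pmf (R : realType) (n : nat) (p q : R)
    (E : {set {set vertex n}}) : R :=
  \prod_(e in vertex_pairs n)
    (if e \in E then edge_prob p q e else 1 - edge_prob p q e).

Definition sbm_prob (R : realType) (n : nat) (p q : R)
    (Q : {set {set vertex n}} -> Prop) : R :=
  \sum_(E in powerset (vertex_pairs n) | `[< Q E >]) sbm_pmf p q E.

Definition whp (R : realType) (p q : nat -> R)
    (Q : forall n : nat, {set {set vertex n}} -> Prop) : Prop :=
  exists2 c : R, 0 < c &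
    \forall n \near \oo, 1 - n%:R `^ (- c) <= sbm_prob (p n) (q n) (@Q n).

(** ** Best-of-three on the graph with vertex set V and edge set E.
    A state is the set of vertices with opinion 1. *)

Section BestOfThree.
Variables (R : realType) (V : finType) (E : {set {set V}}).
Implicit Types (A B N : {set V}) (v : V).

Definition nbrs v : {set V} := [set u | [set u; v]%SET \in E]%SET.

(** Ordered samples (with replacement) of three elements of [N] of which
    at least two lie in [A]. *)
Definition majority_samples N A : {set V * V * V} :=
  [set s : V * V * V |
    [&& s.1.1 \in N, s.1.2 \in N, s.2 \in N &
        (2 <= (s.1.1 \in A) + (s.1.2 \in A) + (s.2 \in A))%N]]%SET.

(** Probability that [v] has opinion 1 after one step. Since [x / 0 = 0],
    an isolated vertex, which has nothing to sample, gets opinion 2. *)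
Definition adopt_prob A v : R :=
  #|majority_samples (nbrs v) A|%:R / #|nbrs v|%:R ^+ 3.

Definition bo3_step A B : R :=
  \prod_(v : V) (if v \in B then adopt_prob A v else 1 - adopt_prob A v).

(** [X] is a realization on the probability space [(T, P)] of the process
    started at [A], i.e. of the Markov chain with transition matrix [bo3_step]. *)
Definition best_of_three A d (T : measurableType d) (P : probability T R)
    (X : nat -> T -> {set V}) : Prop :=
  (forall t B, measurable [set w | X t w = B]) /\
  (forall t (a : nat -> {set V}),
     P [set w | forall s, (s <= t)%N -> X s w = a s] =
     ((a 0%N == A)%:R * \prod_(s < t) bo3_step (a s) (a s.+1))%:E).

Definition consensus A : Prop := A = finset.set0 \/ A = [set: V]%SET.

Definition Tcons (x : nat -> {set V}) : \bar R :=
  ereal_inf [set t%:R%:E | t in [set t : nat | consensus (x t)]].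

(** "Pr[ev (Tcons)] >= b". By Kolmogorov's extension theorem a realization of the
    process exists, and the law of [Tcons] is the same for all realizations;
    hence the quantification over realizations. *)
Definition Tcons_prob_ge A (ev : \bar R -> Prop) (b : R) : Prop :=
  forall d (T : measurableType d) (P : probability T R) (X : nat -> T -> {set V}),
    best_of_three A P X ->
    (b%:E <= P [set w | ev (Tcons (fun t => X t w))])%E.

Lemma card_majority_samples N A :
  #|majority_samples N A| =
  (#|N :&: A| ^ 3 + 3 * (#|N :&: A| ^ 2 * #|N :\: A|))%N.
Proof.
set a := (N :&: A)%SET; set b := (N :\: A)%SET.
pose S1 := finset.setX (finset.setX a a) N.
pose S2 := finset.setX (finset.setX a b) a.
pose S3 := finset.setX (finset.setX b a) a.
have -> : majority_samples N A = (S1 :|: (S2 :|: S3))%SET.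
  apply/setP => -[[x y] z]; rewrite !inE /=.
  by case: (x \in N); case: (y \in N); case: (z \in N);
     case: (x \in A); case: (y \in A); case: (z \in A).
have d23 : (S2 :&: S3 = finset.set0)%SET.
  apply/setP => -[[x y] z]; rewrite !inE /=.
  by case: (x \in A); rewrite ?andbF.
have d1 : (S1 :&: (S2 :|: S3) = finset.set0)%SET.
  apply/setP => -[[x y] z]; rewrite !inE /=.
  by case: (x \in A); case: (y \in A); rewrite ?andbF ?orbF.
rewrite !cardsU d23 d1 !cards0 !subn0 !cardsX -(cardsID A N) -/a -/b.
ring.
Qed.

Lemma adopt_probE A v :
  let x : R := #|nbrs v :&: A|%:R / #|nbrs v|%:R in
  adopt_prob A v = 3 * x ^+ 2 - 2 * x ^+ 3.
Proof.
move=> x; rewrite /adopt_prob {}/x.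
have [N0|N0] := eqVneq (#|nbrs v|%:R : R) 0.
  by rewrite N0 expr0n invr0 !mulr0 !expr0n !mulr0 subr0.
rewrite card_majority_samples natrD !natrM.
have -> : #|nbrs v :\: A|%:R = #|nbrs v|%:R - #|nbrs v :&: A|%:R :> R.
  by rewrite -(cardsID A (nbrs v)) natrD [X in X - _]addrC addrK.
field.
exact: N0.
Qed.

End BestOfThree.

Definition imbalanced (R : realType) (n : nat) (kappa : R)
    (A : {set vertex n}) : Prop :=
  kappa * n%:R <= `| #|A|%:R - #|(~: A)%SET|%:R |.

(* Main.v *)
Require Import Defs.
From HB Require Import structures.
From mathcomp Require Import all_boot all_order all_algebra.
From mathcomp Require Import all_classical all_reals all_analysis.
From mathcomp Require Import ring lra.
Set Implicit Arguments.
Unset Strict Implicit.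
Unset Printing Implicit Defensive.
Import Order.TTheory GRing.Theory Num.Theory.
Import numFieldNormedType.Exports.
Local Open Scope classical_set_scope.
Local Open Scope ring_scope.

(** A set [A] of opinion 1 has two coordinates [coords A = (s, d)]: with the
    densities of [A] in the blocks rescaled to [-1, 1], they are half the sum and
    half the difference. On a typical graph one step changes [(s, d)], up to a
    small error and an exponentially small probability, by the deterministic map
    [flow], in which the graph enters only through [u = (1 - r) / (1 + r)]
    ([coords_step]). The value [r = 1/7] is [u = 3/4]. On the axis [s = 0] the map
    has, for [u > 2/3], a fixed point with [(u d)^2 = 3 - 2 / u], near which [s] is
    multiplied by about [3 / u - 3]. So the two polarized blocks are stable against a
    small imbalance exactly when [u > 3/4].

    For [u > 3/4] a box around the fixed point is mapped well inside itself
    ([flow_trap]), hence the process leaves it with probability at most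
    [exp(-c n)] per step ([survival_trapped]). The box contains sets with imbalance of order [n], and it
    contains no consensus.

    For [u < 3/4] every orbit of the map that starts with [s <> 0] converges to
    consensus, uniformly for [|s|] bounded below ([iter_flow_consensus]), so that
    after a constant number of steps one opinion is confined to a small fraction
    of the vertices ([survival_pseudo_orbit]). From there two mechanisms act. A
    minority of density [x] is in expectation replaced by one of density of order
    [x (sqrt x + m^(-1/2))], where [m = n p] is the order of the degrees
    ([minority_drift]). While it has more than about [sqrt n] members it
    concentrates around this expectation; the first term takes [O(log log n)]
    steps and the second one [O(log n / log m)] steps ([exponent_ge]). Below [sqrt n]
    the expected size contracts by a power of [m] in each step, so that after another
    [O(log n / log m)] steps Markov's inequality leaves nobody
    ([survival_minority_small]).

    Three properties of the graph are used. [low_discrepancy]: the edge counts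
    between any two sets are close to their means; a union bound over the [16^n] pairs of sets suffices as soon
    as [n p] tends to infinity. [regular_degrees]: all degrees are of order [n p];
    this is where [n p >> log n] is needed. [sparse]: few vertices have a large
    share of their neighbours in a small set; the estimate on [sqrt x + m^(-1/2)]
    above comes from here and replaces a bound on the spectral gap.

    The graph and a step of the process are both random subsets with independent
    memberships, so that all tail bounds are instances of [chernoff]. *)

(** * Tail bounds for random subsets *)

Lemma expR_le_inv (R : realType) (x : R) : x < 1 -> expR x <= (1 - x)^-1.
Proof.
move=> x1; rewrite -[x]opprK expRN lef_pV2 ?posrE ?expR_gt0 ?opprK //.
  by rewrite -{1}[x]opprK opprK expR_ge1Dx.
by rewrite subr_gt0.
Qed.

Lemma expR_le_quad (R : realType) (x : R) :
  x <= 1 / 2 -> expR x <= 1 + x + 2 * x ^+ 2.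
Proof.
move=> x2; apply: le_trans (expR_le_inv _) _; first lra.
rewrite -div1r ler_pdivrMr; last lra.
have -> : (1 + x + 2 * x ^+ 2) * (1 - x) = 1 + x ^+ 2 * (1 - 2 * x) by ring.
by rewrite lerDl mulr_ge0 ?sqr_ge0 //; lra.
Qed.

Section ProductMeasure.
Variables (R : realType) (T : finType).
Implicit Types (a w : T -> R) (B : {set T}) (Q : pred {set T}).

(** The common form of [bo3_step] and, with weight 0 outside the pairs of vertices,
    of [sbm_pmf]. *)
Definition random_subset a B : R :=
  \prod_(v : T) (if v \in B then a v else 1 - a v).

Definition subset_prob a Q : R := \sum_(B | Q B) random_subset a B.

Lemma random_subset_ge0 a B :
  (forall v, 0 <= a v <= 1) -> 0 <= random_subset a B.
Proof.
move=> a01; apply: prodr_ge0 => v _; have /andP[? ?] := a01 v.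
by case: ifP => _ //; rewrite subr_ge0.
Qed.

Lemma subset_prob_ge0 a Q : (forall v, 0 <= a v <= 1) -> 0 <= subset_prob a Q.
Proof. by move=> a01; apply: sumr_ge0 => B _; apply: random_subset_ge0. Qed.

(** By independence the exponential moment is a product. *)
Lemma expR_sum_random_subset a w :
  \sum_B random_subset a B * expR (\sum_(v in B) w v) =
  \prod_v (1 + a v * (expR (w v) - 1)).
Proof.
transitivity (\prod_v (a v * expR (w v) + (1 - a v))); last first.
  by apply: eq_bigr => v _; ring.
rewrite bigA_distr; apply: eq_bigr => B _.
rewrite expR_sum (big_mkcond (fun v => v \in B)) -big_split /=.
by apply: eq_bigr => v _; case: ifP => _ //; rewrite mulr1.
Qed.

Lemma random_subset_sum1 a : \sum_B random_subset a B = 1.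
Proof.
have := expR_sum_random_subset a (fun=> 0).
rewrite [X in _ = X]big1 => [<-|v _]; last by rewrite expR0 subrr mulr0 addr0.
by apply: eq_bigr => B _; rewrite big1 // expR0 mulr1.
Qed.

Lemma subset_probC a Q :
  subset_prob a Q = 1 - subset_prob a (fun B => ~~ Q B).
Proof. by rewrite -(random_subset_sum1 a) (bigID Q) /= addrK. Qed.

Lemma le_subset_prob a Q Q' : (forall v, 0 <= a v <= 1) ->
  (forall B, Q B -> Q' B) -> subset_prob a Q <= subset_prob a Q'.
Proof.
move=> a01 QQ'; rewrite /subset_prob big_mkcond [leRHS]big_mkcond /=.
apply: ler_sum => B _; case: ifP => [/QQ' -> //|_].
by case: ifP => _ //; apply: random_subset_ge0.
Qed.

Lemma subset_probU a Q Q' : (forall v, 0 <= a v <= 1) ->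
  subset_prob a (fun B => Q B || Q' B) <= subset_prob a Q + subset_prob a Q'.
Proof.
move=> a01; rewrite /subset_prob (big_mkcond Q) (big_mkcond Q') -big_split /=.
rewrite big_mkcond /=; apply: ler_sum => B _.
have p0 := random_subset_ge0 B a01.
by case: (Q B); case: (Q' B) => /=; rewrite ?addr0 ?add0r // lerDl.
Qed.

Lemma subset_prob_exists (I : finType) a (P : pred I) (Q : I -> pred {set T}) :
  (forall v, 0 <= a v <= 1) ->
  subset_prob a (fun B => [exists i, P i && Q i B]) <=
    \sum_(i | P i) subset_prob a (Q i).
Proof.
move=> a01; rewrite /subset_prob.
under [leRHS]eq_bigr do rewrite big_mkcond.
rewrite exchange_big big_mkcond /=; apply: ler_sum => B _.
have p0 := random_subset_ge0 B a01.
have s0 (J : pred I) : 0 <= \sum_(i | J i) (if Q i B then random_subset a B else 0).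
  by apply: sumr_ge0 => i _; case: ifP.
case: ifP => [/existsP[i /andP[Pi Qi]]|_]; last exact: s0.
by rewrite (bigD1 i) //= Qi lerDl s0.
Qed.

(** Markov's inequality for the exponential of the sum; every tail bound below
    is an instance, for the graph as well as for a step of the process. *)
Lemma chernoff a w t : (forall v, 0 <= a v <= 1) ->
  subset_prob a (fun B => t <= \sum_(v in B) w v) <=
    expR (\sum_v a v * (expR (w v) - 1) - t).
Proof.
move=> a01; rewrite expRD expRN ler_pdivlMr ?expR_gt0 //.
apply: (@le_trans _ _ (\sum_B random_subset a B * expR (\sum_(v in B) w v))).
  rewrite /subset_prob mulr_suml big_mkcond /=; apply: ler_sum => B _.
  have p0 := random_subset_ge0 B a01.
  case: ifP => [tB|_]; last by rewrite mulr_ge0 ?expR_ge0.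
  by rewrite ler_wpM2l // ler_expR.
rewrite expR_sum_random_subset expR_sum; apply: ler_prod => v _.
rewrite expR_ge1Dx andbT -[leRHS]/(1 + a v * (expR (w v) - 1)).
have /andP[a0 a1] := a01 v.
have -> : 1 + a v * (expR (w v) - 1) = (1 - a v) + a v * expR (w v) by ring.
by rewrite addr_ge0 ?mulr_ge0 ?expR_ge0 ?subr_ge0.
Qed.

(** Bernstein's form of the bound, from [exp x <= 1 + x + 2 x^2]. *)
Lemma chernoff_dev a w t l M : (forall v, 0 <= a v <= 1) -> 0 <= l ->
  (forall v, l * w v <= 1 / 2) -> \sum_v a v * w v ^+ 2 <= M ->
  subset_prob a (fun B => \sum_v a v * w v + t <= \sum_(v in B) w v) <=
    expR (2 * l ^+ 2 * M - l * t).
Proof.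
move=> a01 l0 lw wM.
apply: le_trans (_ : _ <=
  expR (\sum_v a v * (expR (l * w v) - 1) - l * (\sum_v a v * w v + t))) _.
  apply: le_trans (chernoff _ _ a01); apply: le_subset_prob => // B wB.
  by rewrite -mulr_sumr ler_wpM2l.
rewrite ler_expR mulrDr opprD addrA lerD2r.
apply: le_trans (_ : _ <= 2 * l ^+ 2 * \sum_v a v * w v ^+ 2) _; last first.
  by rewrite ler_wpM2l // mulr_ge0 ?sqr_ge0.
rewrite lerBlDr !mulr_sumr -big_split /=; apply: ler_sum => v _.
have /andP[a0 a1] := a01 v.
rewrite mulrCA [l * (_ * _)]mulrCA -mulrDr ler_wpM2l //.
by have := expR_le_quad (lw v); rewrite exprMn; lra.
Qed.

Lemma sum_card_random_subset a :
  \sum_B random_subset a B * #|B|%:R = \sum_v a v.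
Proof.
under eq_bigr do rewrite -sum1_card natr_sum mulr_sumr big_mkcond.
rewrite exchange_big /=; apply: eq_bigr => v _.
rewrite -big_mkcond /=.
pose F u := if u == v then 0 else 1 - a u.
transitivity (\prod_u (a u + F u)); last first.
  rewrite (bigD1 v) //= /F eqxx addr0 big1 ?mulr1 // => u /negPf ->.
  by rewrite addrC subrK.
rewrite bigA_distr big_mkcond /=; apply: eq_bigr => B _.
case: ifPn => [vB|vB].
  rewrite mulr1; apply: eq_bigr => u _; rewrite /F.
  by case: ifPn => // uB; case: eqP => // uv; rewrite uv vB in uB.
by apply/esym/eqP; rewrite prodf_seq_eq0; apply/hasP; exists v;
  rewrite ?mem_index_enum //= (negPf vB) /F eqxx.
Qed.

Lemma sum_expr_card (x : R) : \sum_(B : {set T}) x ^+ #|B| = (1 + x) ^+ #|T|.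
Proof.
transitivity (\prod_(v : T) (x + 1)); last first.
  by rewrite prodr_const cardT -cardE addrC.
rewrite bigA_distr; apply: eq_bigr => B _.
rewrite -big_mkcond /= prodr_const //.
Qed.

(** In the union bounds over sets, a factor [x ^+ #|B|] in the probability pays for
    the number of sets; this avoids bounds on binomial coefficients. *)
Lemma sum_expr_card_le (x : R) : 0 <= x ->
  \sum_(B : {set T}) x ^+ #|B| <= expR (x * #|T|%:R).
Proof.
move=> x0; rewrite sum_expr_card [x * _]mulrC expRM_natl.
by apply: lerXn2r; rewrite ?nnegrE ?expR_ge0 ?expR_ge1Dx ?addr_ge0.
Qed.

End ProductMeasure.

(** * The probability of avoiding consensus *)

Lemma adopt_prob_01 (R : realType) (V : finType) (E : {set {set V}}) A v :
  0 <= adopt_prob R E A v <= 1.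
Proof.
rewrite /adopt_prob divr_ge0 ?exprn_ge0 //=.
have [->|N0] := eqVneq (#|nbrs E v|%:R : R) 0.
  by rewrite expr0n invr0 mulr0.
rewrite ler_pdivrMr ?exprn_gt0 ?lt0r ?N0 ?ler0n // mul1r -natrX ler_nat.
rewrite (_ : (_ ^ 3)%N = #|finset.setX (finset.setX (nbrs E v) (nbrs E v)) (nbrs E v)|).
  apply: subset_leq_card; apply/fintype.subsetP => s; rewrite !inE.
  by case/and4P => -> -> ->.
by rewrite !cardsX; ring.
Qed.

Section Survival.
Variables (R : realType) (V : finType) (E : {set {set V}}).
Implicit Types (A B : {set V}) (G : pred {set V}).

Definition consensusb A := (A == finset.set0) || (A == [set: V]%SET).

Lemma consensusP A : reflect (consensus A) (consensusb A).
Proof.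
by apply: (iffP orP) => -[] H; [left|right|left|right]; apply/eqP.
Qed.

(** The probability that none of the times [0, ..., k] is a consensus. The
    recursion on the first step makes it possible to argue backwards in time,
    without sums over paths. *)
Fixpoint survival k A : R :=
  if consensusb A then 0
  else if k is k'.+1 then \sum_B bo3_step R E A B * survival k' B else 1.

Lemma survival_consensus k A : consensusb A -> survival k A = 0.
Proof. by case: k => [|k] /= ->. Qed.

Lemma survival0 A : ~~ consensusb A -> survival 0 A = 1.
Proof. by move=> /= /negPf ->. Qed.

Lemma survivalS k A : ~~ consensusb A ->
  survival k.+1 A = \sum_B bo3_step R E A B * survival k B.
Proof. by move=> /= /negPf ->. Qed.

Lemma bo3_step_ge0 A B : 0 <= bo3_step R E A B.
Proof. exact: (random_subset_ge0 _ (adopt_prob_01 R E A)). Qed.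

Lemma survival_ge0 k A : 0 <= survival k A.
Proof.
elim: k A => [|k IH] A /=; case: ifP => _ //.
by apply: sumr_ge0 => B _; rewrite mulr_ge0 ?bo3_step_ge0.
Qed.

Lemma survival_le1 k A : survival k A <= 1.
Proof.
elim: k A => [|k IH] A /=; case: ifP => _ //.
rewrite -(random_subset_sum1 (adopt_prob R E A)); apply: ler_sum => B _.
by rewrite ler_piMr ?bo3_step_ge0.
Qed.

Lemma survival_step_le k A G c : 0 <= c ->
  (forall B, G B -> ~~ consensusb B -> survival k B <= c) ->
  survival k.+1 A <= subset_prob (adopt_prob R E A) (fun B => ~~ G B) + c.
Proof.
move=> c0 Gc; have [cA|ncA] := boolP (consensusb A).
  by rewrite survival_consensus // addr_ge0 // subset_prob_ge0 //; exact: adopt_prob_01.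
rewrite survivalS // /subset_prob.
apply: (@le_trans _ _ (\sum_B bo3_step R E A B * ((~~ G B)%:R + c))).
  apply: ler_sum => B _; rewrite ler_wpM2l ?bo3_step_ge0 //.
  have [cB|ncB] := boolP (consensusb B).
    by rewrite survival_consensus // addr_ge0.
  case: (boolP (G B)) => [GB|nGB] /=; first by rewrite add0r Gc.
  by rewrite -[leLHS]addr0 lerD // survival_le1.
under eq_bigr do rewrite mulrDr.
rewrite big_split /= -mulr_suml.
rewrite [X in X * c](random_subset_sum1 (adopt_prob R E A)) mul1r lerD2r.
rewrite [leRHS]big_mkcond /=; apply: ler_sum => B _.
by case: (G B); rewrite /= ?mulr0 ?mulr1.
Qed.

(** Reduces a stretch during which the process concentrates to a sequence of
    deterministic sets that lead to one another; the failures add up. *)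
Lemma survival_chain_le M k (G : nat -> pred {set V}) eps c :
  0 <= eps -> 0 <= c ->
  (forall i A, (i < M)%N -> ~~ consensusb A -> G i A ->
     subset_prob (adopt_prob R E A) (fun B => ~~ G i.+1 B) <= eps) ->
  (forall A, ~~ consensusb A -> G M A -> survival k A <= c) ->
  forall A, G 0%N A -> survival (M + k) A <= M%:R * eps + c.
Proof.
move=> e0 c0; elim: M G => [|M IH] G Geps Gc A GA.
  rewrite add0n mul0r add0r; have [cA|ncA] := boolP (consensusb A).
    by rewrite survival_consensus.
  exact: Gc.
have [cA|ncA] := boolP (consensusb A).
  by rewrite survival_consensus // addr_ge0 // mulr_ge0.
rewrite addSn -natr1 mulrDl mul1r [_ + eps]addrC -addrA.
apply: le_trans (survival_step_le (G := G 1%N) (c := M%:R * eps + c) _ _ _) _.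
- by rewrite addr_ge0 // mulr_ge0.
- move=> B GB ncB; apply: (IH (fun i => G i.+1)) => // i A' iM; exact: Geps.
- by rewrite lerD2r Geps.
Qed.

(** Escaping from [G] is a rare event in each step, and before it happens there
    is no consensus. *)
Lemma survival_invariant_ge k G eps :
  0 <= eps ->
  (forall A, G A -> ~~ consensusb A) ->
  (forall A, G A -> subset_prob (adopt_prob R E A) (fun B => ~~ G B) <= eps) ->
  forall A, G A -> 1 - k%:R * eps <= survival k A.
Proof.
move=> e0 Gn Geps; elim: k => [|k IH] A GA.
  by rewrite mul0r subr0 survival0 // Gn.
rewrite survivalS ?Gn //.
have [le1|lt1] := lerP (1 - k%:R * eps) 0.
  apply: le_trans (_ : 0 <= _).
    by apply: le_trans le1; rewrite lerD2l lerN2 ler_wpM2r // ler_nat.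
  by apply: sumr_ge0 => B _; rewrite mulr_ge0 ?bo3_step_ge0 ?survival_ge0.
apply: (@le_trans _ _ ((1 - eps) * (1 - k%:R * eps))).
  rewrite -natr1; have : 0 <= eps * (k%:R * eps) by rewrite !mulr_ge0.
  lra.
apply: (@le_trans _ _ (subset_prob (adopt_prob R E A) G * (1 - k%:R * eps))).
  by rewrite ler_pM2r // subset_probC lerD2l lerN2 Geps.
rewrite /subset_prob mulr_suml big_mkcond /=; apply: ler_sum => B _.
case: ifP => GB; last by rewrite mulr_ge0 ?bo3_step_ge0 ?survival_ge0.
by rewrite ler_wpM2l ?bo3_step_ge0 ?IH.
Qed.

Section Realization.
Variables (A : {set V}) (d : measure_display) (T : measurableType d).
Variables (P : probability T R) (X : nat -> T -> {set V}).
Hypothesis XP : best_of_three E A P X.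

Let path_avoid k j (a : nat -> {set V}) := [set w |
  (forall s, (s <= k)%N -> X s w = a s) /\
  (forall s, (k <= s <= k + j)%N -> ~ consensus (X s w))].

Lemma measurable_state_pred (Q : {set V} -> Prop) t :
  measurable [set w | Q (X t w)].
Proof.
have -> : [set w | Q (X t w)] = \bigcup_(B in [set B | Q B]) [set w | X t w = B].
  by apply/seteqP; split=> w /= => [Qw|[B QB ->]]; [exists (X t w)|].
by apply: fin_bigcup_measurable => // B _; case: XP.
Qed.

Lemma measurable_states_pred (D : pred nat) (Q : nat -> {set V} -> Prop) :
  measurable [set w | forall s, D s -> Q s (X s w)].
Proof.
have -> : [set w | forall s, D s -> Q s (X s w)] =
          \bigcap_s [set w | D s -> Q s (X s w)].
  by apply/seteqP; split=> w /= H s; move: (H s) => // /(_ I).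
apply: bigcap_measurable => // s _.
exact: (@measurable_state_pred (fun B => D s -> Q s B)).
Qed.

Lemma measurable_path_avoid k j a : measurable (path_avoid k j a).
Proof.
apply: measurableI.
  exact: (@measurable_states_pred (fun s => (s <= k)%N) (fun s B => B = a s)).
exact: (@measurable_states_pred (fun s => (k <= s <= k + j)%N) (fun=> fun B => ~ consensus B)).
Qed.

(** The event that prescribes the path until time [k] and avoids consensus from
    then on is the disjoint union, over the values at time [k + 1], of events of the
    same kind. So the recursion of [survival] follows from the cylinder
    probabilities alone. *)
Lemma prob_path_avoid j k (a : nat -> {set V}) :
  P (path_avoid k j a) =
  ((a 0%N == A)%:R * (\prod_(s < k) bo3_step R E (a s) (a s.+1)) *
     survival j (a k))%:E.
Proof.
elim: j k a => [|j IH] k a; (have [cA|ncA] := boolP (consensusb (a k));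
  [rewrite survival_consensus // mulr0 (_ : path_avoid _ _ _ = set0) ?measure0 //;
   rewrite -subset0 => w [/(_ k (leqnn k)) Xk /(_ k)];
   rewrite leqnn leq_addr => /(_ isT); rewrite Xk;
   by move/(consensusP _): cA|]).
  rewrite survival0 // mulr1 -(XP.2 k a); congr (P _).
  apply/seteqP; split=> w /= => [[]//|Hw]; split=> // s.
  by rewrite addn0 -eqn_leq => /eqP <-; rewrite Hw // => /(consensusP _); rewrite (negPf ncA).
rewrite survivalS //.
pose b B s := if s == k.+1 then B else a s.
have -> : path_avoid k j.+1 a = \bigcup_(B in [set` index_enum {set V}]) path_avoid k.+1 j (b B).
  apply/seteqP; split=> w /=.
    move=> [wa wn]; exists (X k.+1 w); first exact: mem_index_enum.
    split=> s sk.
      rewrite /b; case: eqP => [->//|/eqP sk1]; apply: wa.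
      by rewrite -ltnS ltn_neqAle sk1.
    by case/andP: sk => sk sj; apply: wn; rewrite (ltnW sk) -addSnnS.
  move=> [B _ [wa wn]]; split=> s sk.
    by rewrite wa ?(leqW sk) // /b ltn_eqF.
  have [->|sk1] := eqVneq s k.
    rewrite wa // /b ltn_eqF //; exact/consensusP.
  case/andP: sk => sk sj; apply: wn.
  by rewrite addSnnS sj andbT ltn_neqAle eq_sym sk1.
rewrite measure_fin_bigcup //; last first.
- by move=> B _; exact: measurable_path_avoid.
- apply/trivIsetP => B C _ _ BC; rewrite -subset0 => w [[wB _] [wC _]].
  have : b B k.+1 = b C k.+1 by rewrite -wB // -wC.
  by rewrite /b eqxx => /eqP; rewrite (negPf BC).
rewrite -fsbig_seq ?index_enum_uniq //.
rewrite (eq_bigr _ (fun B _ => IH k.+1 (b B))) sumEFin mulr_sumr; congr (_%:E); apply: eq_bigr => B _.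
rewrite big_ord_recr /= /b eqxx [k == _]ltn_eqF // !mulrA; congr (_ * _ * _ * _).
apply: eq_bigr => s _.
by rewrite !ltn_eqF // ltnS ?leqW // ltnW.
Qed.

Lemma prob_avoid_consensus k :
  P [set w | forall s, (s <= k)%N -> ~ consensus (X s w)] = (survival k A)%:E.
Proof.
have := prob_path_avoid k 0 (fun=> A); rewrite eqxx big_ord0 !mul1r => <-.
have PX0 : P [set w | X 0%N w = A] = 1%E.
  have := XP.2 0%N (fun=> A); rewrite eqxx big_ord0 mul1r => <-.
  by congr (P _); apply/seteqP; split=> w /= => [Xw [|//]//|]; apply.
set N := [set w | _].
have mN : measurable N.
  exact: (@measurable_states_pred (fun s => (s <= k)%N) (fun=> fun B => ~ consensus B)).
have -> : path_avoid 0 k (fun=> A) = N `&` [set w | X 0%N w = A].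
  apply/seteqP; split=> w /= [].
    by move=> Xw Yw; split=> [s sk|]; [exact: Yw|exact: Xw].
  by move=> Yw Xw; split=> [[|//]//|s sk]; exact: Yw.
have mX0 : measurable [set w | X 0%N w = A] by case: XP.
rewrite -{1}(setIT N) -(setUv [set w | X 0%N w = A]) setIUr measureU //.
- rewrite [X in (_ + X)%E](_ : _ = 0%E) ?adde0 //.
  apply/eqP; rewrite eq_le measure_ge0 andbT.
  apply: le_trans (_ : P (~` [set w | X 0%N w = A]) <= _)%E.
    apply: le_measure; rewrite ?inE; last by apply: subIsetr.
      by apply: measurableI => //; exact: measurableC.
    exact: measurableC.
  by rewrite probability_setC // PX0 subee.
- exact: measurableI.
- by apply: measurableI => //; exact: measurableC.
- by rewrite setIACA setICr setI0.
Qed.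

End Realization.

Lemma Tcons_le_intro (x : nat -> {set V}) t (c : R) :
  consensus (x t) -> t%:R <= c -> (Tcons R x <= c%:E)%E.
Proof.
move=> xt tc; apply: le_trans (_ : t%:R%:E <= _)%E; last by rewrite lee_fin.
by apply: ereal_inf_lbound; exists t.
Qed.

Lemma Tcons_leP (x : nat -> {set V}) (c : R) :
  (Tcons R x <= c%:E)%E -> exists2 t : nat, t%:R <= c & consensus (x t).
Proof.
move=> xc; apply: contrapT => nx.
have [t xt] : exists t, consensus (x t).
  apply: contrapT => nt; move: xc; rewrite /Tcons.
  rewrite (_ : [set s%:R%:E | s in _] = set0) ?ereal_inf0 //.
  by rewrite -subset0 => z [s xs _]; apply: nt; exists s.
have ex : exists t, `[< consensus (x t) >] by exists t; apply/asboolP.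
case: (ex_minnP ex) => m /asboolP xm mmin.
have : (m%:R%:E <= c%:E :> \bar R)%E.
  apply: le_trans xc; apply: le_ereal_inf_tmp => _ [s xs <-].
  by rewrite lee_fin ler_nat mmin //; apply/asboolP.
by rewrite lee_fin => mc; apply: nx; exists m.
Qed.

Lemma Tcons_ge_intro (x : nat -> {set V}) k (c : R) :
  (forall s, (s <= k)%N -> ~ consensus (x s)) -> c <= k.+1%:R ->
  (c%:E <= Tcons R x)%E.
Proof.
move=> xk ck; apply: le_ereal_inf_tmp => _ [s xs <-].
rewrite lee_fin (le_trans ck) // ler_nat ltnNge; apply/negP => sk.
exact: xk xs.
Qed.

(** A condition on each coordinate, hence a measurable event. *)
Lemma Tcons_geP (x : nat -> {set V}) (c : R) :
  (c%:E <= Tcons R x)%E <-> (forall s : nat, s%:R < c -> ~ consensus (x s)).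
Proof.
split=> [cx s sc xs|H].
  have : (c%:E <= s%:R%:E :> \bar R)%E.
    by apply: le_trans cx _; apply: ereal_inf_lbound; exists s.
  by rewrite lee_fin leNgt sc.
apply: le_ereal_inf_tmp => _ [s xs <-]; rewrite lee_fin leNgt; apply/negP => sc.
exact: H xs.
Qed.

Lemma Tcons_prob_le A k (c b : R) : k%:R <= c -> b <= 1 - survival k A ->
  Tcons_prob_ge E A (fun t : \bar R => (t <= c%:E)%E) b.
Proof.
move=> kc bk d T P X XP.
set S := [set w | _].
have mN : measurable [set w | forall s, (s <= k)%N -> ~ consensus (X s w)].
  exact: (measurable_states_pred XP (fun s => (s <= k)%N) (fun=> fun B => ~ consensus B)).
apply: le_trans (_ : P (~` [set w | forall s, (s <= k)%N -> ~ consensus (X s w)]) <= _)%E.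
  by rewrite probability_setC // (prob_avoid_consensus XP) lee_fin.
apply: le_measure; rewrite ?inE.
- exact: measurableC.
- have -> : S = ~` [set w | forall s, s%:R <= c -> ~ consensus (X s w)].
    apply/seteqP; split=> w /=.
      by move=> /Tcons_leP[s sc xs] /(_ s sc).
    by move=> /existsNP[s /not_implyP[sc /contrapT xs]]; exact: Tcons_le_intro xs sc.
  apply: measurableC.
  exact: (measurable_states_pred XP (fun s => s%:R <= c) (fun=> fun B => ~ consensus B)).
- move=> w /= /existsNP[s /not_implyP[sk /contrapT xs]].
  by apply: Tcons_le_intro xs _; apply: le_trans kc; rewrite ler_nat.
Qed.

Lemma Tcons_prob_ge_survival A k (c b : R) : c <= k.+1%:R -> b <= survival k A ->
  Tcons_prob_ge E A (fun t : \bar R => (c%:E <= t)%E) b.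
Proof.
move=> kc bk d T P X XP.
apply: le_trans (_ : P [set w | forall s, (s <= k)%N -> ~ consensus (X s w)] <= _)%E.
  by rewrite (prob_avoid_consensus XP) lee_fin.
apply: le_measure; rewrite ?inE.
- exact: (measurable_states_pred XP (fun s => (s <= k)%N) (fun=> fun B => ~ consensus B)).
- have -> : [set w | (c%:E <= Tcons R (X ^~ w))%E] =
            [set w | forall s : nat, s%:R < c -> ~ consensus (X s w)].
    by apply/seteqP; split=> w /= /Tcons_geP.
  exact: (measurable_states_pred XP (fun s => s%:R < c) (fun=> fun B => ~ consensus B)).
- by move=> w /= H; exact: Tcons_ge_intro H kc.
Qed.

End Survival.

(** * The mean-field map *)

Section Dynamics.
Variables (R : realType) (u : R).
Implicit Types (s d z e : R) (x y : R * R).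

(** The polynomial [3 x^2 - 2 x^3] conjugated from [0, 1] to [-1, 1]. *)
Definition maj z : R := (3 * z - z ^+ 3) / 2.

(** A vertex sees the opinions of its own block mixed with those of the other one:
    the mean [x.1] of the two imbalances is common to both blocks, and the
    half-difference [x.2] is seen damped by the factor [u], with opposite signs. *)
Definition flow x : R * R :=
  ((maj (x.1 + u * x.2) + maj (x.1 - u * x.2)) / 2,
   (maj (x.1 + u * x.2) - maj (x.1 - u * x.2)) / 2).
Arguments flow : simpl never.

Lemma flow1E s d :
  (flow (s, d)).1 = s * (3 - s ^+ 2 - 3 * (u * d) ^+ 2) / 2.
Proof. by rewrite /flow /maj /=; field. Qed.

Lemma flow2E s d :
  (flow (s, d)).2 = u * d * (3 - (u * d) ^+ 2 - 3 * s ^+ 2) / 2.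
Proof. by rewrite /flow /maj /=; field. Qed.

Lemma maj_le1 z : -1 <= z <= 1 -> -1 <= maj z <= 1.
Proof.
move=> /andP[z0 z1]; rewrite /maj.
have e1 : 1 - (3 * z - z ^+ 3) / 2 = (1 - z) ^+ 2 * (2 + z) / 2 by field.
have e2 : 1 + (3 * z - z ^+ 3) / 2 = (1 + z) ^+ 2 * (2 - z) / 2 by field.
have h1 : 0 <= (1 - z) ^+ 2 * (2 + z) / 2.
  by rewrite divr_ge0 // mulr_ge0 ?sqr_ge0 //; lra.
have h2 : 0 <= (1 + z) ^+ 2 * (2 - z) / 2.
  by rewrite divr_ge0 // mulr_ge0 ?sqr_ge0 //; lra.
lra.
Qed.

Lemma maj_lip z e : -1 <= z <= 1 -> -1 <= e <= 1 ->
  `|maj z - maj e| <= 3 / 2 * `|z - e|.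
Proof.
move=> /andP[z0 z1] /andP[e0 e1].
have -> : maj z - maj e = (3 - z ^+ 2 - z * e - e ^+ 2) / 2 * (z - e).
  by rewrite /maj; field.
rewrite normrM ler_wpM2r // ler_norml.
by apply/andP; split; nra.
Qed.

Definition in_diamond x := `|x.1| + `|x.2| <= 1.

Hypothesis u01 : 0 <= u <= 1.

Lemma in_diamond_arg x : in_diamond x ->
  (-1 <= x.1 + u * x.2 <= 1) && (-1 <= x.1 - u * x.2 <= 1).
Proof.
rewrite /in_diamond => xd; have /andP[u0 u1] := u01.
have : `|x.1 + u * x.2| <= 1.
  apply: le_trans (ler_normD _ _) _; apply: le_trans xd.
  by rewrite lerD2l normrM (ger0_norm u0) ler_piMl.
have : `|x.1 - u * x.2| <= 1.
  apply: le_trans (ler_normB _ _) _; apply: le_trans xd.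
  by rewrite lerD2l normrM (ger0_norm u0) ler_piMl.
by rewrite !ler_norml => -> ->.
Qed.

Lemma flow_in_diamond x : in_diamond x -> in_diamond (flow x).
Proof.
move=> /in_diamond_arg/andP[/maj_le1 + /maj_le1]; rewrite /in_diamond /flow /=.
move: (maj _) (maj _) => a b /andP[a0 a1] /andP[b0 b1].
by case: (ger0P ((b + a) / 2)) => h1; case: (ger0P ((b - a) / 2)) => h2; lra.
Qed.

Lemma iter_flow_in_diamond M x : in_diamond x -> in_diamond (iter M flow x).
Proof. by move=> xd; elim: M => //= M; exact: flow_in_diamond. Qed.

Lemma flow_lip x y e : in_diamond x -> in_diamond y ->
  `|x.1 - y.1| <= e -> `|x.2 - y.2| <= e ->
  `|(flow x).1 - (flow y).1| <= 3 * e /\ `|(flow x).2 - (flow y).2| <= 3 * e.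
Proof.
move=> /in_diamond_arg/andP[xp xm] /in_diamond_arg/andP[yp ym] xy1 xy2.
have /andP[u0 u1] := u01.
have ud : `|u * (x.2 - y.2)| <= e.
  by rewrite normrM (ger0_norm u0) (le_trans _ xy2) // ler_piMl.
have hp : `|maj (x.1 + u * x.2) - maj (y.1 + u * y.2)| <= 3 * e.
  apply: le_trans (maj_lip xp yp) _.
  have -> : x.1 + u * x.2 - (y.1 + u * y.2) = x.1 - y.1 + u * (x.2 - y.2) by ring.
  by have := ler_normD (x.1 - y.1) (u * (x.2 - y.2)); lra.
have hm : `|maj (x.1 - u * x.2) - maj (y.1 - u * y.2)| <= 3 * e.
  apply: le_trans (maj_lip xm ym) _.
  have -> : x.1 - u * x.2 - (y.1 - u * y.2) = x.1 - y.1 - u * (x.2 - y.2) by ring.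
  by have := ler_normB (x.1 - y.1) (u * (x.2 - y.2)); lra.
move: hp hm; rewrite /flow /= !ler_norml => /andP[? ?] /andP[? ?].
by split; apply/andP; split; lra.
Qed.

Definition abs_pair x : R * R := (`|x.1|, `|x.2|).

Definition in_quadrant x := [&& 0 <= x.1, 0 <= x.2 & x.1 + x.2 <= 1].

Lemma in_quadrantE s d :
  in_quadrant (s, d) = [&& 0 <= s, 0 <= d & s + d <= 1].
Proof. by []. Qed.

Lemma flow_in_quadrant x : in_quadrant x -> in_quadrant (flow x).
Proof.
case: x => s d; rewrite {1}in_quadrantE => /and3P[s0 d0 sd]; have /andP[u0 u1] := u01.
have ud0 : 0 <= u * d by rewrite mulr_ge0.
have ud1 : u * d <= d by rewrite ler_piMl.
have s2 : s ^+ 2 <= s by rewrite expr2 ler_piMl //; lra.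
have ud2 : (u * d) ^+ 2 <= u * d by rewrite expr2 ler_piMl //; lra.
apply/and3P; split.
- by rewrite flow1E divr_ge0 // mulr_ge0 //; lra.
- by rewrite flow2E divr_ge0 // mulr_ge0 //; lra.
- have /maj_le1/andP[_] : -1 <= s + u * d <= 1 by lra.
  rewrite /flow /=; lra.
Qed.

Lemma iter_flow_in_quadrant M x : in_quadrant x -> in_quadrant (iter M flow x).
Proof. by move=> xd; elim: M => //= M; exact: flow_in_quadrant. Qed.

(** Exchanging the opinions or the blocks commutes with the map, so that its orbits
    may be studied in a quadrant. *)
Lemma abs_pair_flow x : in_diamond x -> abs_pair (flow x) = flow (abs_pair x).
Proof.
case: x => s d xd; have /flow_in_quadrant/and3P[] : in_quadrant (abs_pair (s, d)).
  by rewrite /in_quadrant /= !normr_ge0.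
rewrite /abs_pair [(s, d).1]/= [(s, d).2]/= => f1 f2 _.
rewrite [RHS]surjective_pairing -[in RHS](ger0_norm f1) -[in RHS](ger0_norm f2).
rewrite !flow1E !flow2E.
have n2 z : `|z| ^+ 2 = z ^+ 2 by rewrite real_normK ?num_real.
rewrite !exprMn !n2; congr (_, _).
  by rewrite !normrM !normr_id.
by rewrite !normrM !normr_id.
Qed.

Lemma abs_pair_iter_flow M x : in_diamond x ->
  abs_pair (iter M flow x) = iter M flow (abs_pair x).
Proof.
move=> xd; elim: M => //= M IH.
by rewrite abs_pair_flow ?IH //; exact: iter_flow_in_diamond.
Qed.

Lemma exists_expr_le (c e : R) : 0 <= c < 1 -> 0 < e -> exists M : nat, c ^+ M <= e.
Proof.
move=> /andP[c0 c1] e0.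
have cc : `|c| < 1 by rewrite ger0_norm.
have /cvgrPdist_le/(_ e e0) := cvg_expr cc.
move=> [M _ /(_ M (leqnn M))] /=; rewrite sub0r normrN => h.
by exists M; apply: le_trans h; exact: ler_norm.
Qed.

Lemma flow1_ge_half s d : in_quadrant (s, d) -> u < 3 / 4 ->
  s / 2 <= (flow (s, d)).1.
Proof.
rewrite {1}in_quadrantE => /and3P[s0 d0 sd] u34; have /andP[u0 u1] := u01.
rewrite flow1E ler_pM2r ?invr_gt0 // ler_peMr //.
have ud0 : 0 <= u * d by rewrite mulr_ge0.
have ud1 : u * d <= 3 / 4 * d by rewrite ler_wpM2r // ltW.
by nra.
Qed.

Lemma iter_flow1_ge M x : in_quadrant x -> u < 3 / 4 ->
  x.1 / 2 ^+ M <= (iter M flow x).1.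
Proof.
move=> xq u34; elim: M => [|M IH]; first by rewrite expr0 divr1.
rewrite iterS [iter M flow x]surjective_pairing.
apply: le_trans (flow1_ge_half _ u34); last by rewrite -surjective_pairing iter_flow_in_quadrant.
by rewrite exprSr invfM mulrA ler_wpM2r.
Qed.

(** With respect to the threshold [1/3] on [(u d)^2], the antisymmetric
    coordinate contracts above, because [u (3 - 1/3) / 2 < 1], and cannot
    escape from below. *)
Lemma flow2_threshold s d : in_quadrant (s, d) -> u < 3 / 4 ->
  ((u * d) ^+ 2 <= 1 / 3 -> (u * (flow (s, d)).2) ^+ 2 <= 1 / 3) /\
  (1 / 3 <= (u * d) ^+ 2 -> (flow (s, d)).2 <= 4 / 3 * u * d).
Proof.
move=> sdq u34; have /and3P[_ f0 _] := flow_in_quadrant sdq.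
move: sdq f0; rewrite {1}in_quadrantE => /and3P[s0 d0 sd] f0.
have /andP[u0 u1] := u01.
have ud0 : 0 <= u * d by rewrite mulr_ge0.
have s2 := sqr_ge0 s.
have f2 : (flow (s, d)).2 <= u * d * (3 - (u * d) ^+ 2) / 2.
  by rewrite flow2E ler_pM2r ?invr_gt0 // ler_wpM2l //; lra.
split=> h.
  set D := (u * d) ^+ 2 in h f2.
  have D0 : 0 <= D by exact: sqr_ge0.
  have le1 : (u * (flow (s, d)).2) ^+ 2 <= (3 / 4) ^+ 2 * (D * (3 - D) ^+ 2 / 4).
    have -> : D * (3 - D) ^+ 2 / 4 = (u * d * (3 - D) / 2) ^+ 2.
      by rewrite /D; field.
    rewrite exprMn; apply: ler_pM; rewrite ?sqr_ge0 //.
      by rewrite ler_pXn2r ?nnegrE // ltW.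
    rewrite ler_pXn2r ?nnegrE //; by apply: le_trans f2.
  apply: le_trans le1 _.
  have : D * (3 - D) ^+ 2 <= 64 / 27.
    have -> : D * (3 - D) ^+ 2 = 64 / 27 - (1 / 3 - D) * (D ^+ 2 - 17 / 3 * D + 64 / 9) by field.
    rewrite gerBl mulr_ge0 //; first lra.
    by nra.
  by lra.
apply: le_trans f2 _.
have -> : u * d * (3 - (u * d) ^+ 2) / 2 = u * d * ((3 - (u * d) ^+ 2) / 2) by ring.
have -> : 4 / 3 * u * d = u * d * (4 / 3) by ring.
by rewrite ler_wpM2l //; lra.
Qed.

Lemma iter_flow_threshold : u < 3 / 4 -> exists M : nat, forall x, in_quadrant x ->
  (u * (iter M flow x).2) ^+ 2 <= 1 / 3.
Proof.
move=> u34; have /andP[u0 u1] := u01.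
have [M Mh] : exists M : nat, (4 / 3 * u) ^+ M <= 1 / 2.
  by apply: exists_expr_le; lra.
exists M => x xq.
have : (u * (iter M flow x).2) ^+ 2 <= 1 / 3 \/ (iter M flow x).2 <= (4 / 3 * u) ^+ M.
  elim: {Mh} M => [|M IH].
    by right; move: xq => /and3P[/= ? ? ?]; rewrite expr0 /=; lra.
  have yq := iter_flow_in_quadrant M xq.
  have [lo hi] : ((u * (iter M flow x).2) ^+ 2 <= 1 / 3 ->
      (u * (flow (iter M flow x)).2) ^+ 2 <= 1 / 3) /\
    (1 / 3 <= (u * (iter M flow x).2) ^+ 2 ->
      (flow (iter M flow x)).2 <= 4 / 3 * u * (iter M flow x).2).
    by move: yq; case: (iter M flow x) => s d yq; exact: flow2_threshold.
  rewrite iterS.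
  case: (lerP ((u * (iter M flow x).2) ^+ 2) (1 / 3)) => [le|/ltW gt].
    by left; apply: lo.
  case: IH => [le|IH]; first by left; exact: lo.
  right; apply: le_trans (hi gt) _.
  by rewrite exprS ler_wpM2l //; lra.
case=> // h.
have /and3P[_ f0 _] := iter_flow_in_quadrant M xq.
have : u * (iter M flow x).2 <= 3 / 4 * (1 / 2).
  by apply: ler_pM => //; [exact: ltW|exact: le_trans h Mh].
have : 0 <= u * (iter M flow x).2 by rewrite mulr_ge0.
by nra.
Qed.

(** Below the threshold the ratio of the coordinates contracts; at [s = 0] and
    [(u d)^2 = 1/3] the factor is [4 u / 3], so that [3/4] is critical. *)
Lemma flow_ratio s d : in_quadrant (s, d) -> u < 3 / 4 ->
  (u * d) ^+ 2 <= 1 / 3 ->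
  (flow (s, d)).2 * s <= (2 / 3 + 4 / 9 * u) * (flow (s, d)).1 * d.
Proof.
rewrite {1}in_quadrantE => /and3P[s0 d0 sd] u34; have /andP[u0 u1] := u01.
rewrite flow1E flow2E.
set D := (u * d) ^+ 2 => D3.
have D0 : 0 <= D by exact: sqr_ge0.
set S := s ^+ 2.
have S0 : 0 <= S by exact: sqr_ge0.
have S1 : S <= 1 by rewrite /S expr_le1 //; lra.
have -> : u * d * (3 - D - 3 * S) / 2 * s = s * d / 2 * (u * (3 - D - 3 * S)) by ring.
have -> : (2 / 3 + 4 / 9 * u) * (s * (3 - S - 3 * D) / 2) * d =
  s * d / 2 * ((2 / 3 + 4 / 9 * u) * (3 - S - 3 * D)) by ring.
apply: ler_wpM2l; first by rewrite divr_ge0 // mulr_ge0.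
suff : 0 <= 3 - S - 3 * D - u * (3 - D - 3 * S) - (1 - 4 / 3 * u).
  have : 0 <= (1 - 4 / 3 * u) * (S + 3 * D).
    by rewrite mulr_ge0 //; lra.
  lra.
have -> : 3 - S - 3 * D - u * (3 - D - 3 * S) - (1 - 4 / 3 * u) =
  (1 - S) * (1 - 4 / 3 * u) + S * (5 / 3 * u) + (3 - u) * (1 / 3 - D) by field.
by rewrite !addr_ge0 // mulr_ge0 //; lra.
Qed.

Lemma iter_flow_ratio M x rho : in_quadrant x -> u < 3 / 4 -> 0 < x.1 ->
  (u * x.2) ^+ 2 <= 1 / 3 -> 0 <= rho -> x.2 <= rho * x.1 ->
  (u * (iter M flow x).2) ^+ 2 <= 1 / 3 /\
  (iter M flow x).2 <= (2 / 3 + 4 / 9 * u) ^+ M * rho * (iter M flow x).1.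
Proof.
move=> xq u34 x1 xD r0 xr; have /andP[u0 u1] := u01.
elim: M => [|M [ID IR]]; first by split=> //=; rewrite expr0 mul1r.
have yq := iter_flow_in_quadrant M xq.
have y1 : 0 < (iter M flow x).1.
  by apply: lt_le_trans (iter_flow1_ge M xq u34); rewrite divr_gt0 // exprn_gt0.
rewrite iterS; move: yq y1 ID IR; case: (iter M flow x) => s d yq /= y1 ID IR.
have [lo _] := flow2_threshold yq u34; split; first exact: lo.
have /and3P[f1 f2 _] := flow_in_quadrant yq.
have c0 : 0 <= 2 / 3 + 4 / 9 * u by lra.
have h := flow_ratio yq u34 ID.
rewrite exprS; move: (2 / 3 + 4 / 9 * u) c0 h IR => c c0 h IR.
rewrite -(ler_pM2r y1); apply: le_trans h _.
have -> : c * c ^+ M * rho * (flow (s, d)).1 * s =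
  c * (flow (s, d)).1 * (c ^+ M * rho * s) by ring.
by rewrite ler_wpM2l // mulr_ge0.
Qed.

(** When the antisymmetric coordinate is negligible, the symmetric one follows
    [maj], for which 1 is attracting and 0 repelling. *)
Lemma flow1_grow s d eta : in_quadrant (s, d) -> 0 < eta <= 1 / 2 ->
  d <= eta / 3 ->
  (s <= 1 - eta -> (1 + eta / 4) * s <= (flow (s, d)).1) /\
  (1 - eta <= s -> 1 - eta <= (flow (s, d)).1).
Proof.
rewrite {1}in_quadrantE => /and3P[s0 d0 sd] /andP[e0 e1] de; have /andP[u0 u1] := u01.
have D1 : 3 * (u * d) ^+ 2 <= eta / 2.
  have : (u * d) ^+ 2 <= (eta / 3) ^+ 2.
    rewrite ler_pXn2r ?nnegrE ?mulr_ge0 //; last lra.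
    by apply: le_trans de; rewrite ler_piMl.
  have : eta ^+ 2 <= eta * (1 / 2) by rewrite expr2 ler_wpM2l // ltW.
  by rewrite exprMn; lra.
rewrite flow1E; move: D1; set D := (u * d) ^+ 2 => D1.
have s1 : s <= 1 by lra.
have s2 : s ^+ 2 <= s by rewrite expr2 ler_piMl.
split=> se.
  rewrite [leLHS]mulrC -mulrA ler_wpM2l //; lra.
have -> : s * (3 - s ^+ 2 - 3 * D) / 2 = 1 - (1 - s) ^+ 2 * (2 + s) / 2 - s * (3 * D) / 2.
  by field.
have h1 : (1 - s) ^+ 2 * (2 + s) <= (eta * (1 / 2)) * 3.
  apply: ler_pM; rewrite ?sqr_ge0 //; try lra.
  by rewrite expr2; apply: ler_pM; lra.
have h2 : s * (3 * D) <= 1 * (eta / 2).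
  by apply: ler_pM; rewrite // mulr_ge0 // sqr_ge0.
lra.
Qed.

(** Below the critical value every orbit that starts with a positive
    imbalance approaches consensus, uniformly in the starting point: first the
    antisymmetric coordinate falls below the threshold, then it becomes
    negligible with respect to the symmetric one, and then the latter grows. *)
Lemma iter_flow_consensus_quadrant kappa eta : u < 3 / 4 -> 0 < kappa -> 0 < eta ->
  exists M : nat, forall x, in_quadrant x -> kappa <= x.1 ->
    1 - eta <= (iter M flow x).1.
Proof.
move=> u34 k0 eta0; have /andP[u0 u1] := u01.
pose e := Num.min eta (1 / 2).
have e0 : 0 < e by rewrite lt_min eta0; lra.
have e12 : e <= 1 / 2 by rewrite ge_min lexx orbT.
have ee : e <= eta by rewrite ge_min lexx.
have [M1 hM1] := iter_flow_threshold u34.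
pose k1 := kappa / 2 ^+ M1.
have k10 : 0 < k1 by rewrite divr_gt0 // exprn_gt0.
have [M2 hM2] : exists M : nat, (2 / 3 + 4 / 9 * u) ^+ M <= k1 * (e / 3).
  by apply: exists_expr_le; [lra|rewrite mulr_gt0 // divr_gt0].
pose k2 := k1 / 2 ^+ M2.
have k20 : 0 < k2 by rewrite divr_gt0 // exprn_gt0.
have [M3 hM3] : exists M : nat, (1 + e / 4)^-1 ^+ M <= k2.
  by apply: exists_expr_le => //; rewrite invr_ge0 invf_lt1; lra.
exists (M3 + (M2 + M1))%N => x xq xk.
apply: le_trans (_ : 1 - e <= _); first lra.
rewrite !iterD.
have yq := iter_flow_in_quadrant M1 xq.
have yD := hM1 _ xq.
have y1 : k1 <= (iter M1 flow x).1.
  apply: le_trans (iter_flow1_ge M1 xq u34).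
  by rewrite /k1 ler_pM2r // invr_gt0 exprn_gt0.
move: (iter M1 flow x) yq yD y1 => y yq yD y1.
have y0 : 0 < y.1 by exact: lt_le_trans y1.
have yr : y.2 <= k1^-1 * y.1.
  have /and3P[_ _ yy] := yq.
  apply: le_trans (_ : 1 <= _); first lra.
  by rewrite mulrC ler_pdivlMr // mul1r.
have k1i : 0 <= k1^-1 by rewrite invr_ge0 ltW.
have hr M := iter_flow_ratio M yq u34 y0 yD k1i yr.
have zr M : (iter M flow (iter M2 flow y)).2 <= e / 3.
  have /and3P[q1 q2 q3] := iter_flow_in_quadrant (M + M2) yq.
  have [_] := hr (M + M2)%N; rewrite -iterD => h; apply: le_trans h _.
  apply: le_trans (_ : (2 / 3 + 4 / 9 * u) ^+ (M + M2) * k1^-1 * 1 <= _).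
    rewrite ler_wpM2l //; last lra.
    by rewrite mulr_ge0 // exprn_ge0; lra.
  rewrite mulr1 ler_pdivrMr //; apply: le_trans (_ : _ <= (2 / 3 + 4 / 9 * u) ^+ M2) _.
    rewrite exprD ler_piMl ?exprn_ge0 ?exprn_ile1 //; lra.
  by rewrite [leRHS]mulrC.
have z1 : k2 <= (iter M2 flow y).1.
  apply: le_trans (iter_flow1_ge M2 yq u34).
  by rewrite /k2 ler_pM2r // invr_gt0 exprn_gt0.
have zq := iter_flow_in_quadrant M2 yq.
move: (iter M2 flow y) zq z1 zr => z zq z1 zr.
have : 1 - e <= (iter M3 flow z).1 \/ (1 + e / 4) ^+ M3 * k2 <= (iter M3 flow z).1.
  elim: {hM3} M3 => [|M IH]; first by right; rewrite expr0 mul1r.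
  have wq := iter_flow_in_quadrant M zq.
  have e01 : 0 < e <= 1 / 2 by rewrite e0.
  move: (iter_flow_in_quadrant M zq) (zr M); rewrite iterS.
  case: (iter M flow z) IH => s d /= IH sq dr.
  have [up stay] := flow1_grow sq e01 dr.
  case: (lerP (1 - e) s) => [/stay|/ltW se]; first by left.
  case: IH => [/stay|IH]; first by left.
  right; apply: le_trans (up se).
  by rewrite exprS -mulrA ler_wpM2l //; lra.
case=> // h; apply: le_trans h.
apply: le_trans (_ : 1 <= _); first lra.
have p0 : 0 < (1 + e / 4) ^+ M3 by rewrite exprn_gt0 //; lra.
by rewrite mulrC -ler_pdivrMr // mul1r -exprVn.
Qed.

Lemma iter_flow_consensus kappa eta : u < 3 / 4 -> 0 < kappa -> 0 < eta ->
  exists M : nat, forall x, in_diamond x -> kappa <= `|x.1| ->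
    1 - eta <= `|(iter M flow x).1|.
Proof.
move=> u34 k0 eta0; have [M hM] := iter_flow_consensus_quadrant u34 k0 eta0.
exists M => x xd xk; have := hM (abs_pair x); rewrite -abs_pair_iter_flow //.
by apply; rewrite // /in_quadrant /= !normr_ge0.
Qed.

(** Above the critical value the fixed point of [flow] on the axis [s = 0],
    [(u d)^2 = 3 - 2 / u], attracts a neighbourhood. The lower end of the box
    below has [(u d)^2] halfway between the threshold and the fixed point. *)
Lemma flow_trap : 3 / 4 < u -> exists s0 d0 e : R,
  [/\ 0 < s0, 0 < d0, d0 + s0 <= 1, 0 < e &
   forall s d, `|s| <= s0 -> d0 <= d <= 1 ->
     `|(flow (s, d)).1| <= s0 - e /\ d0 + e <= (flow (s, d)).2].
Proof.
move=> u34; have /andP[u0 u1] := u01; have up : 0 < u by lra.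
pose D0 := 5 / 3 - u^-1.
have ui : u^-1 < 4 / 3 by rewrite invf_plt ?posrE //; lra.
have ui1 : 1 <= u^-1 by rewrite invf_ge1.
have uui : u * u^-1 = 1 by rewrite divff // gt_eqF.
pose w := Num.sqrt D0.
have w0 : 0 < w by rewrite sqrtr_gt0 /D0; lra.
have w2 : w ^+ 2 = D0 by rewrite sqr_sqrtr // /D0; lra.
have w1 : w <= 1.
  rewrite -(@expr_le1 _ 2) // ?ltW // w2 /D0; lra.
pose d0 := w / u.
have ud0 : u * d0 = w by rewrite /d0 mulrC divfK // gt_eqF.
pose ga := w * (2 / 3 - u^-1 / 2).
have ga0 : 0 < ga by rewrite mulr_gt0 //; lra.
have hd0 : w * (3 - w ^+ 2) / 2 = d0 + ga by rewrite w2 /D0 /ga /d0; field; rewrite gt_eqF.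
have dg1 : d0 + ga <= 1.
  have /maj_le1/andP[_] : -1 <= w <= 1 by lra.
  by rewrite -hd0 /maj; have -> : 3 * w - w ^+ 3 = w * (3 - w ^+ 2) by ring.
pose s0 := ga / 6.
have s00 : 0 < s0 by rewrite divr_gt0.
have d00 : 0 < d0 by rewrite divr_gt0.
have s01 : s0 <= 1 by rewrite /s0; lra.
pose c := 4 - 3 * u^-1.
exists s0, d0, (Num.min (s0 * (c / 2)) (ga / 2)); split => //.
- by rewrite /s0; lra.
- by rewrite lt_min !divr_gt0 // mulr_gt0 // /c; lra.
move=> s d ss /andP[dd d1].
have dp : 0 <= d by lra.
have udw : w <= u * d by rewrite -ud0 ler_wpM2l.
have ud1 : u * d <= 1 by rewrite mulr_ile1.
have udp : 0 <= u * d by rewrite mulr_ge0.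
have s2 : s ^+ 2 <= s0 ^+ 2.
  by rewrite -(real_normK (num_real s)) ler_pXn2r ?nnegrE // ltW.
have s02 : s0 ^+ 2 <= s0 by rewrite expr2 ler_piMl // ltW.
have ud2 : D0 <= (u * d) ^+ 2 by rewrite -w2 ler_pXn2r ?nnegrE // ltW.
have ud21 : (u * d) ^+ 2 <= 1 by rewrite expr_le1.
have sq0 := sqr_ge0 s.
split.
  apply: le_trans (_ : s0 - s0 * (c / 2) <= _); last first.
    by rewrite lerD2l lerN2 ge_min lexx.
  rewrite flow1E -mulrA normrM.
  have -> : s0 - s0 * (c / 2) = s0 * (1 - c / 2) by ring.
  apply: ler_pM => //; rewrite ler_norml /c; move: ud2; rewrite /D0 => ud2.
  by apply/andP; split; lra.
apply: le_trans (_ : d0 + ga / 2 <= _).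
  by rewrite lerD2l ge_min lexx orbT.
rewrite flow2E.
have h1 : w * (3 - w ^+ 2) <= u * d * (3 - (u * d) ^+ 2).
  rewrite -subr_ge0.
  have -> : u * d * (3 - (u * d) ^+ 2) - w * (3 - w ^+ 2) =
    (u * d - w) * (3 - (u * d) ^+ 2 - (u * d) * w - w ^+ 2) by ring.
  have ww : w ^+ 2 <= 1 by rewrite expr_le1 // ltW.
  have : u * d * w <= 1 by rewrite mulr_ile1 // ltW.
  by move=> ?; rewrite mulr_ge0 //; lra.
have h2 : u * d * s ^+ 2 <= s0.
  apply: le_trans (_ : 1 * s0 ^+ 2 <= _); last by rewrite mul1r.
  by apply: ler_pM.
have -> : u * d * (3 - (u * d) ^+ 2 - 3 * s ^+ 2) / 2 =
  u * d * (3 - (u * d) ^+ 2) / 2 - 3 / 2 * (u * d * s ^+ 2) by ring.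
by move: h2; rewrite /s0; lra.
Qed.

End Dynamics.

(** * Edge counts of the block model *)

Section EdgeCounts.
Variable V : finType.
Implicit Types (E : {set {set V}}) (S A B e : {set V}) (u v : V).

(** Counted with orientation: an edge inside [S :&: A] counts twice. *)
Definition edges E S A : nat := (\sum_(v in S) #|nbrs E v :&: A|)%N.

(** [edges E S A] is the sum of these weights over [E], which is the form required by
    [chernoff]. *)
Definition multiplicity S A e : nat :=
  (\sum_(v in S) \sum_(u in A) ([set u; v]%SET == e))%N.

Lemma card_nbrsI E v A : #|nbrs E v :&: A| = (\sum_(u in A) ([set u; v]%SET \in E))%N.
Proof.
rewrite -sum1_card [LHS]big_mkcond [RHS]big_mkcond /=; apply: eq_bigr => u _.
by rewrite !inE andbC; case: (u \in A); case: (_ \in E).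
Qed.

Lemma sum_multiplicity (R : realType) (F : {set V} -> R) S A :
  \sum_e F e * (multiplicity S A e)%:R =
  \sum_(v in S) \sum_(u in A) F [set u; v]%SET.
Proof.
under eq_bigr => e _.
  rewrite /multiplicity natr_sum mulr_sumr.
  under eq_bigr do rewrite natr_sum mulr_sumr.
  over.
rewrite exchange_big; apply: eq_bigr => v _.
rewrite exchange_big; apply: eq_bigr => u _.
rewrite (bigD1 [set u; v]%SET) //= eqxx mulr1 big1 ?addr0 // => e.
by rewrite eq_sym => /negPf ->; rewrite mulr0.
Qed.

Lemma edgesE (R : realType) E S A :
  (edges E S A)%:R = \sum_(e in E) (multiplicity S A e)%:R :> R.
Proof.
transitivity (\sum_e (e \in E)%:R * (multiplicity S A e)%:R : R).
  rewrite sum_multiplicity /edges natr_sum; apply: eq_bigr => v _.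
  by rewrite card_nbrsI natr_sum.
rewrite [RHS]big_mkcond /=; apply: eq_bigr => e _.
by case: (e \in E); rewrite ?mul1r ?mul0r.
Qed.

Lemma eq_set2r u u' v : ([set u; v] = [set u'; v])%SET -> u = u'.
Proof.
move=> /setP uu'; have := uu' u; have := uu' u'; rewrite !inE !eqxx /=.
have [->|uv] := eqVneq u v; first by rewrite !orbb => /eqP ->.
by rewrite orbF => _ /esym/eqP.
Qed.

Lemma multiplicity_le2 S A e : (multiplicity S A e <= 2)%N.
Proof.
have inner v : (\sum_(u in A) ([set u; v]%SET == e) <= ((v \in e) && (#|e| <= 2)))%N.
  have [/existsP[u /andP[uA /eqP ue]]|/existsPn h] :=
    boolP [exists u, (u \in A) && ([set u; v]%SET == e)].
    rewrite (bigD1 u) //= -ue eqxx big1 ?addn0 => [|u' /andP[_ u'u]].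
      by rewrite !inE eqxx orbT /= cards2; case: (_ != _).
    by apply/eqP; rewrite eqb0; apply: contraNneq u'u => /eq_set2r ->.
  rewrite big1 // => u uA; apply/eqP; rewrite eqb0.
  by have := h u; rewrite uA.
apply: (@leq_trans (\sum_(v : V) ((v \in e) && (#|e| <= 2)))%N).
  rewrite /multiplicity big_mkcond /=; apply: leq_sum => v _.
  by case: ifP => _ //; exact: inner.
case: (leqP #|e| 2) => e2.
  apply: leq_trans e2; rewrite -sum1_card [leqRHS]big_mkcond /=.
  by apply: leq_sum => v _; rewrite andbT; case: (v \in e).
by under eq_bigr do rewrite andbF; rewrite big1.
Qed.

Lemma edges_setT E v : edges E [set v]%SET [set: V]%SET = #|nbrs E v|.
Proof. by rewrite /edges big_set1 finset.setIT. Qed.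

End EdgeCounts.

Section Graph.
Variables (R : realType) (n : nat) (p q : R).
Hypotheses (q0 : 0 <= q) (qp : q <= p) (p1 : p <= 1).
Implicit Types (E : {set {set vertex n}}) (S A B e : {set vertex n}).
Implicit Types (u v : vertex n).

Definition sbm_weight e : R := if e \in vertex_pairs n then edge_prob p q e else 0.

Definition pair_prob v u : R := if u.1 == v.1 then p else q.

(** Includes the pairs [v = u], which are never edges, so as to depend only on the
    sizes of the parts of [S] and [A] in the blocks; [mean_edges_bounds] accounts for
    the difference. *)
Definition expected_edges S A : R := \sum_(v in S) \sum_(u in A) pair_prob v u.

Lemma sbm_weight_01 e : 0 <= sbm_weight e <= 1.
Proof.
rewrite /sbm_weight /edge_prob; case: ifP => _; last by rewrite lexx ler01.
case: ifP => _; apply/andP; split=> //; first exact: le_trans qp.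
exact: le_trans qp p1.
Qed.

Lemma sbm_weightE u v :
  sbm_weight [set u; v]%SET = if u == v then 0 else pair_prob v u.
Proof.
rewrite /sbm_weight inE cards2; have [//|uv /=] := eqVneq u v.
rewrite /edge_prob /pair_prob.
suff -> : same_block [set u; v]%SET = (u.1 == v.1) by [].
apply/forall_inP/eqP => [h|vu1 x].
  have /forall_inP h' := h u (set21 u v).
  by have /eqP := h' v (set22 u v).
by rewrite !inE => /orP[] /eqP ->; apply/forall_inP => y;
  rewrite !inE => /orP[] /eqP ->; rewrite ?vu1.
Qed.

Lemma sbm_pmfE E : (E \subset vertex_pairs n)%SET ->
  sbm_pmf p q E = random_subset sbm_weight E.
Proof.
move=> EU; rewrite /random_subset (bigID (fun e => e \in vertex_pairs n)) /=.
rewrite [X in _ = _ * X]big1 ?mulr1 => [|e eU]; last first.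
  rewrite ifN; last by apply: contra eU; apply: (fintype.subsetP EU).
  by rewrite /sbm_weight (negPf eU) subr0.
by apply: eq_bigr => e eU; rewrite /sbm_weight eU.
Qed.

Lemma sbm_prob_ge (Q : {set {set vertex n}} -> Prop) (bad : pred {set {set vertex n}}) :
  (forall E, (E \subset vertex_pairs n)%SET -> ~~ bad E -> Q E) ->
  1 - subset_prob sbm_weight bad <= sbm_prob p q Q.
Proof.
move=> badQ; rewrite (subset_probC _ bad) opprB addrC subrK.
rewrite /subset_prob (bigID (fun E : {set {set vertex n}} => E \subset vertex_pairs n)%SET) /=.
rewrite [X in _ + X]big1 ?addr0 => [|E /andP[_ /fintype.subsetPn[e eE eU]]]; last first.
  apply/eqP; rewrite prodf_seq_eq0; apply/hasP; exists e; first exact: mem_index_enum.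
  by rewrite /= eE /sbm_weight (negPf eU).
rewrite /sbm_prob big_mkcond [leRHS]big_mkcond /=; apply: ler_sum => E _.
rewrite inE; have p0 := random_subset_ge0 E sbm_weight_01.
have [EU|EU] := boolP (E \subset vertex_pairs n)%SET; rewrite ?andbF ?andbT //=.
case: ifPn => [nb|_]; last by case: ifP => _ //; rewrite sbm_pmfE.
by rewrite ifT ?sbm_pmfE //; apply/asboolP; exact: badQ.
Qed.

Lemma pair_prob_ge0 v u : 0 <= pair_prob v u.
Proof. by rewrite /pair_prob; case: ifP => _ //; exact: le_trans qp. Qed.

Lemma pair_prob_lep v u : pair_prob v u <= p.
Proof. by rewrite /pair_prob; case: ifP. Qed.

Lemma card_vertex : #|vertex n| = (2 * n)%N.
Proof. by rewrite card_prod card_bool card_ord. Qed.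

Lemma sum_p_card A : \sum_(u in A) p = #|A|%:R * p.
Proof. by rewrite sumr_const mulr_natl. Qed.

Lemma expected_edges_le S A : expected_edges S A <= #|S|%:R * #|A|%:R * p.
Proof.
apply: (@le_trans _ _ (\sum_(v in S) \sum_(u in A) p)).
  by apply: ler_sum => v _; apply: ler_sum => u _; exact: pair_prob_lep.
by rewrite sum_p_card sumr_const -[leLHS]mulr_natl mulrA.
Qed.

Definition mean_edges S A : R := \sum_e sbm_weight e * (multiplicity S A e)%:R.

Lemma mean_edges_bounds S A :
  expected_edges S A - #|S|%:R * p <= mean_edges S A <= expected_edges S A.
Proof.
have p0 : 0 <= p by exact: le_trans qp.
rewrite /mean_edges sum_multiplicity /expected_edges; apply/andP; split.
  rewrite -sum_p_card -sumrB; apply: ler_sum => v _.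
  rewrite lerBlDr; have [vA|vA] := boolP (v \in A).
    rewrite (bigD1 v) //= [leRHS]addrC [X in _ <= _ + X](bigD1 v) //=.
    rewrite sbm_weightE eqxx add0r lerD ?pair_prob_lep //.
    by apply: ler_sum => u /andP[_ uv]; rewrite sbm_weightE (negPf uv).
  apply: ler_wpDr => //; apply: ler_sum => u uA.
  by rewrite sbm_weightE; case: eqVneq uA vA => // -> ->.
apply: ler_sum => v _; apply: ler_sum => u _.
by rewrite sbm_weightE; case: ifP => _ //; exact: pair_prob_ge0.
Qed.

Lemma edges_tails S A l t M : 0 <= l <= 1 / 4 -> expected_edges S A <= M ->
  subset_prob sbm_weight (fun E => mean_edges S A + t <= (edges E S A)%:R) <=
    expR (4 * l ^+ 2 * M - l * t) /\
  subset_prob sbm_weight (fun E => (edges E S A)%:R <= mean_edges S A - t) <=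
    expR (4 * l ^+ 2 * M - l * t).
Proof.
move=> /andP[l0 l4] eM.
have m2 e : (multiplicity S A e)%:R <= 2 :> R by rewrite ler_nat multiplicity_le2.
have v2 : \sum_e sbm_weight e * (multiplicity S A e)%:R ^+ 2 <= 2 * M.
  apply: (@le_trans _ _ (2 * mean_edges S A)); last first.
    by rewrite ler_wpM2l //; have /andP[_ h] := mean_edges_bounds S A; exact: le_trans eM.
  rewrite /mean_edges mulr_sumr; apply: ler_sum => e _; rewrite [leRHS]mulrCA.
  have /andP[w0 _] := sbm_weight_01 e.
  by rewrite ler_wpM2l // expr2 ler_wpM2r.
rewrite (_ : 4 * l ^+ 2 * M = 2 * l ^+ 2 * (2 * M)); last by ring.
split.
  apply: le_trans (chernoff_dev (w := fun e => (multiplicity S A e)%:R) t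
    sbm_weight_01 l0 _ v2).
    by apply: le_subset_prob => [|E]; [exact: sbm_weight_01|rewrite edgesE].
  by move=> e; have := m2 e; have : (0 : R) <= (multiplicity S A e)%:R by []; nra.
apply: le_trans (chernoff_dev (w := fun e => - (multiplicity S A e)%:R) t
    sbm_weight_01 l0 _ _).
- apply: le_subset_prob => [|E]; first exact: sbm_weight_01.
  have -> : \sum_e sbm_weight e * - (multiplicity S A e)%:R = - mean_edges S A.
    by rewrite /mean_edges -sumrN; apply: eq_bigr => e _; rewrite mulrN.
  by rewrite sumrN -edgesE; lra.
- by move=> e; have : (0 : R) <= (multiplicity S A e)%:R by []; nra.
- by under eq_bigr do rewrite sqrrN.
Qed.

(** For counts far above the mean. A multiplicity [w] is 0, 1 or 2, so that
    convexity gives [exp(l w) - 1 <= w / 2 * exp(2 l)]. *)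
Lemma edges_heavy S A l t M : 0 <= l -> expected_edges S A <= M ->
  subset_prob sbm_weight (fun E => t <= (edges E S A)%:R) <=
    expR (M / 2 * expR (2 * l) - l * t).
Proof.
move=> l0 eM.
apply: (@le_trans _ _ (expR (\sum_e sbm_weight e *
    (expR (l * (multiplicity S A e)%:R) - 1) - l * t))).
  apply: le_trans (chernoff _ _ sbm_weight_01).
  apply: le_subset_prob => [|E tE]; first exact: sbm_weight_01.
  by rewrite -mulr_sumr -edgesE ler_wpM2l.
rewrite ler_expR lerD2r.
apply: (@le_trans _ _ (mean_edges S A / 2 * expR (2 * l))); last first.
  rewrite ler_wpM2r ?expR_ge0 // ler_pM2r ?invr_gt0 //.
  by have /andP[_ h] := mean_edges_bounds S A; exact: le_trans eM.
rewrite /mean_edges -mulrA mulr_suml; apply: ler_sum => e _; rewrite -mulrA.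
have /andP[w0 _] := sbm_weight_01 e; rewrite ler_wpM2l //.
have e1 : 1 <= expR l by rewrite -expR0 ler_expR.
have e2 : expR (2 * l) = expR l ^+ 2 by rewrite mulrC expRM_natr.
have := multiplicity_le2 S A e; rewrite e2.
case: (multiplicity S A e) => [|[|[|//]]] _.
- by rewrite mulr0 expR0 subrr mul0r.
- by rewrite mulr1 mul1r; have := sqr_ge0 (expR l - 1); nra.
- by rewrite [l * _]mulrC e2; lra.
Qed.

End Graph.

(** * Properties of typical graphs *)

Lemma expR1_le4 (R : realType) : expR 1 <= 4 :> R.
Proof.
have h : expR (1 / 2) <= 2 :> R.
  by apply: le_trans (expR_le_inv _) _; [lra|rewrite invf_ple ?posrE; lra].
have -> : expR 1 = expR (1 / 2) * expR (1 / 2) :> R.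
  by rewrite -expRD; congr expR; field.
have -> : 4 = 2 * 2 :> R by ring.
by apply: ler_pM; rewrite ?expR_ge0.
Qed.

Lemma expR_lnN (R : realType) (x : R) : 0 < x -> expR (- ln x) = x^-1.
Proof. by move=> x0; rewrite expRN lnK. Qed.

Lemma ln_le_mul_ln_div (R : realType) (x k : R) : 1 <= k -> 0 < x ->
  1 <= ln (x / k) -> ln x <= k * ln (x / k).
Proof.
move=> k1 x0 l1; have k0 : 0 < k by lra.
have e : ln (x / k) = ln x - ln k by rewrite ln_div.
have lk : ln k <= k - 1.
  by have := @le_ln1Dx R (k - 1); rewrite [1 + _]addrC subrK; apply; lra.
have : (k - 1) * 1 <= (k - 1) * ln (x / k) by rewrite ler_wpM2l //; lra.
by move: l1; rewrite e; lra.
Qed.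

(** Plays two roles for a set of density [x], when the degrees are of order [m]: the
    fraction of the degree from which a vertex counts as heavily exposed to the
    set, and the number of such vertices relative to the size of the set. The
    union bound needs the product of the two to be at least of order [1 / m]; the
    term [sqrt x] makes the logarithm of the ratio of the first one to [x] comparable
    with [ln (1 / x)]. *)
Definition infection_rate (R : realType) (m x : R) : R :=
  8 * (Num.sqrt x + (Num.sqrt m)^-1).

Section InfectionRate.
Variables (R : realType) (m x : R).
Hypotheses (m256 : 256 <= m) (x0 : 0 < x) (x256 : x <= 1 / 256).

Let sx0 : 0 < Num.sqrt x. Proof. by rewrite sqrtr_gt0. Qed.
Let sx16 : Num.sqrt x <= 1 / 16.
Proof.
rewrite -[1 / 16]ger0_norm ?divr_ge0 // -sqrtr_sqr ler_wsqrtr //.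
by have -> : (1 / 16) ^+ 2 = 1 / 256 :> R by field.
Qed.
Let sm16 : 16 <= Num.sqrt m.
Proof.
rewrite -[16]ger0_norm // -sqrtr_sqr ler_wsqrtr //.
by have -> : 16 ^+ 2 = 256 :> R by ring.
Qed.
Let sm0 : 0 < Num.sqrt m. Proof. exact: lt_le_trans sm16. Qed.

Lemma infection_rate_gt0 : 0 < infection_rate m x.
Proof. by rewrite mulr_gt0 // addr_gt0 // invr_gt0. Qed.

Lemma infection_rate_le1 : infection_rate m x <= 1.
Proof.
have : (Num.sqrt m)^-1 <= 16^-1 by rewrite lef_pV2 ?posrE.
by have := sx16; rewrite /infection_rate; lra.
Qed.

Lemma infection_rate_sqr : 64 <= infection_rate m x ^+ 2 * m.
Proof.
have m0 : 0 < m by have := m256; lra.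
apply: (@le_trans _ _ ((8 * (Num.sqrt m)^-1) ^+ 2 * m)).
  rewrite exprMn exprVn sqr_sqrtr ?(ltW m0) // -mulrA mulVf ?mulr1 ?gt_eqF //.
  by rewrite -natrX ler_nat.
rewrite ler_wpM2r ?(ltW m0) // ler_pXn2r ?nnegrE ?mulr_ge0 ?invr_ge0 ?addr_ge0 ?invr_ge0 ?sqrtr_ge0 //.
by rewrite ler_wpM2l // lerDr ltW.
Qed.

Lemma infection_rate_ln :
  1 - ln x / 2 <= ln (infection_rate m x / x).
Proof.
have sx := sqr_sqrtr (ltW x0).
have -> : ln x = 2 * ln (Num.sqrt x) by rewrite -{1}sx lnXn // mulr_natl.
apply: (@le_trans _ _ (ln (8 / Num.sqrt x))).
  rewrite ln_div ?posrE //.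
  have : (1 : R) <= ln 8.
    rewrite -[leLHS]expRK ler_ln ?posrE ?expR_gt0 //.
    by apply: le_trans (expR1_le4 R) _; lra.
  lra.
rewrite ler_ln ?posrE ?divr_gt0 ?infection_rate_gt0 //.
rewrite -{3}sx expr2 invfM mulrA ler_pM2r ?invr_gt0 // ler_pdivlMr //.
by rewrite /infection_rate ler_wpM2l // lerDl invr_ge0 ltW.
Qed.

End InfectionRate.

Lemma sum_vertex (R : realType) (n : nat) (F : vertex n -> R) :
  \sum_u F u = \sum_b \sum_(i < n) F (b, i).
Proof.
by rewrite pair_bigA /=; apply: eq_bigr => -[b i] _.
Qed.

Section TypicalGraph.
Variables (R : realType) (n : nat) (p q : R).
Implicit Types (E : {set {set vertex n}}) (S A B : {set vertex n}).

Definition low_discrepancy (eps : R) E : bool :=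
  [forall S : {set vertex n}, forall A : {set vertex n},
    `|(edges E S A)%:R - expected_edges p q S A| <= eps * (n%:R ^+ 2 * p)].

Definition regular_degrees E : bool :=
  [forall v : vertex n, n%:R * p / 2 <= #|nbrs E v|%:R <= 3 * (n%:R * p)].

Definition rate (b : nat) : R := infection_rate (n%:R * p) (b%:R / n%:R).

Definition heavy E B : {set vertex n} :=
  [set v | rate #|B| * (n%:R * p) <= #|nbrs E v :&: B|%:R]%SET.

Definition small_set B : bool := (0 < #|B|)%N && (#|B|%:R / n%:R <= 1 / 256 :> R).

Definition sparse E : bool :=
  [forall B : {set vertex n}, small_set B ==>
    (#|heavy E B|%:R <= rate #|B| * #|B|%:R)].

Hypotheses (q0 : 0 <= q) (qp : q <= p) (p1 : p <= 1).

Let w01 := sbm_weight_01 (n := n) q0 qp p1.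

(** There are [16^n] pairs of sets, and each fails with probability
    [exp(- c n^2 p)]. *)
Lemma prob_not_low_discrepancy eps : 0 < eps <= 1 -> 4 <= eps * n%:R ->
  1280 <= eps ^+ 2 * (n%:R * p) ->
  subset_prob (@sbm_weight R n p q) (fun E => ~~ low_discrepancy eps E) <=
    2 * expR (- n%:R).
Proof.
move=> /andP[e0 e1] en epn; have p0 : 0 <= p by exact: le_trans qp.
pose X : R := n%:R ^+ 2 * p.
have X0 : 0 <= X by rewrite mulr_ge0 ?sqr_ge0.
have le1 S A : subset_prob (@sbm_weight R n p q)
  (fun E => eps * X < `|(edges E S A)%:R - expected_edges p q S A|) <=
    2 * expR (- (5 * n%:R)).
  have card_le (C : {set vertex n}) : #|C|%:R <= 2 * n%:R :> R.
    by rewrite -natrM ler_nat -card_vertex max_card.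
  have eM : expected_edges p q S A <= 4 * X.
    apply: le_trans (expected_edges_le qp S A) _.
    rewrite (_ : 4 * X = (2 * n%:R) * (2 * n%:R) * p); last by rewrite /X; ring.
    by rewrite ler_wpM2r // ler_pM.
  (* The exponent is least at [l = eps / 64]. *)
  have l4 : 0 <= eps / 64 <= 1 / 4 by lra.
  have [up lo] := edges_tails q0 qp p1 (eps / 2 * X) l4 eM.
  have expo : 4 * (eps / 64) ^+ 2 * (4 * X) - eps / 64 * (eps / 2 * X) <= - (5 * n%:R).
    rewrite (_ : _ - _ = - (n%:R * (eps ^+ 2 * (n%:R * p)) / 256)); last by rewrite /X; field.
    have : n%:R * 1280 <= n%:R * (eps ^+ 2 * (n%:R * p)) by rewrite ler_wpM2l.
    lra.
  have /andP[mlo mup] := mean_edges_bounds q0 qp S A.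
  have Sp : #|S|%:R * p <= eps / 2 * X.
    apply: (@le_trans _ _ (2 * n%:R * p)); first by rewrite ler_wpM2r.
    rewrite (_ : eps / 2 * X = (eps * n%:R / 2) * (n%:R * p)); last by rewrite /X; ring.
    rewrite -mulrA ler_wpM2r ?mulr_ge0 //; lra.
  apply: (@le_trans _ _ (expR (4 * (eps / 64) ^+ 2 * (4 * X) - eps / 64 * (eps / 2 * X)) *+ 2)); last first.
    by rewrite -[leLHS]mulr_natl ler_wpM2l // ler_expR.
  rewrite mulr2n; apply: le_trans (lerD up lo); apply: le_trans (subset_probU _ _ w01).
  apply: le_subset_prob => [|E]; first exact: w01.
  rewrite ltNge ler_norml negb_and -!ltNge => /orP[] h; apply/orP; [right|left]; lra.
have sum1 (c : R) : 0 <= c -> \sum_(S : {set vertex n}) c <= expR (2 * n%:R) * c.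
  move=> c0; have := sum_expr_card_le (vertex n) (ler01 : 0 <= 1 :> R).
  rewrite card_vertex mul1r natrM => h; apply: le_trans (ler_wpM2r c0 h).
  by rewrite mulr_suml; apply: ler_sum => S _; rewrite expr1n mul1r.
apply: (@le_trans _ _ (\sum_(S : {set vertex n}) \sum_(A : {set vertex n})
    2 * expR (- (5 * n%:R)))); last first.
  apply: le_trans (ler_sum _ (fun S _ => sum1 _ _)) _; first by rewrite mulr_ge0 ?expR_ge0.
  apply: le_trans (sum1 _ _) _; first by rewrite !mulr_ge0 ?expR_ge0.
  rewrite (_ : forall a b : R, a * (a * (2 * b)) = 2 * (a * a * b)); last by move=> a b; ring.
  rewrite ler_wpM2l // -!expRD ler_expR.
  by have : (0 : R) <= n%:R by []; lra.
apply: le_trans (_ : _ <= \sum_(S : {set vertex n})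
   subset_prob (@sbm_weight R n p q) (fun E => [exists A : {set vertex n},
     eps * X < `|(edges E S A)%:R - expected_edges p q S A|])) _.
  apply: le_trans (subset_prob_exists predT _ w01); apply: le_subset_prob => [|E]; first exact: w01.
  rewrite negb_forall => /existsP[S]; rewrite negb_forall => SE.
  apply/existsP; exists S; move: SE => /existsP[A]; rewrite -ltNge => h.
  by apply/existsP; exists A.
apply: ler_sum => S _.
apply: le_trans (subset_prob_exists predT _ w01) _.
by apply: ler_sum => A _; exact: le1.
Qed.

Lemma prob_not_regular_degrees : (4 <= n)%N ->
  subset_prob (@sbm_weight R n p q) (fun E => ~~ regular_degrees E) <=
    4 * n%:R * expR (- (n%:R * p / 512)).
Proof.
move=> n4; have p0 : 0 <= p by exact: le_trans qp.
have n4' : 4 <= n%:R :> R by rewrite ler_nat.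
have m4 : 4 * p <= n%:R * p by rewrite ler_wpM2r.
have m0 : 0 <= n%:R * p by rewrite mulr_ge0.
have le1 v : subset_prob (@sbm_weight R n p q) (fun E =>
   ~~ (n%:R * p / 2 <= #|nbrs E v|%:R <= 3 * (n%:R * p))) <=
   2 * expR (- (n%:R * p / 512)).
  have up : expected_edges p q [set v]%SET [set: vertex n]%SET <= 2 * (n%:R * p).
    apply: le_trans (expected_edges_le qp _ _) _.
    by rewrite cards1 cardsT card_vertex natrM mul1r mulrA.
  have lo : n%:R * p <= expected_edges p q [set v]%SET [set: vertex n]%SET.
    rewrite /expected_edges big_set1 /pair_prob.
    rewrite (eq_bigl predT) => [|u]; last by rewrite inE.
    rewrite sum_vertex /=.
    rewrite (bigD1 v.1) //= eqxx sumr_const card_ord mulr_natl lerDl.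
    by apply: sumr_ge0 => b _; apply: sumr_ge0 => i _; case: ifP.
  have l4 : (0 <= 1 / 64 :> R) && (1 / 64 <= 1 / 4 :> R) by lra.
  have [tu tl] := edges_tails q0 qp p1 (n%:R * p / 4) l4 up.
  have /andP[] := mean_edges_bounds q0 qp [set v]%SET [set: vertex n]%SET.
  rewrite cards1 mul1r => mlo mup.
  have expo : 4 * (1 / 64) ^+ 2 * (2 * (n%:R * p)) - 1 / 64 * (n%:R * p / 4) = - (n%:R * p / 512).
    by field.
  rewrite expo in tu tl; rewrite [leRHS]mulr_natl [leRHS]mulr2n.
  apply: le_trans (lerD tu tl); apply: le_trans (subset_probU _ _ w01).
  apply: le_subset_prob => [|E]; first exact: w01.
  rewrite /= edges_setT negb_and -!ltNge => /orP[] h; apply/orP; [right|left];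
    lra.
apply: le_trans (_ : _ <= \sum_(v : vertex n) 2 * expR (- (n%:R * p / 512))) _; last first.
  rewrite sumr_const card_vertex -[leLHS]mulr_natl natrM.
  by rewrite (_ : 2 * n%:R * (2 * expR _) = 4 * n%:R * expR (- (n%:R * p / 512))) //; ring.
apply: le_trans (_ : _ <= \sum_(v : vertex n) subset_prob (@sbm_weight R n p q) (fun E =>
   ~~ (n%:R * p / 2 <= #|nbrs E v|%:R <= 3 * (n%:R * p)))) _; last first.
  by apply: ler_sum => v _; exact: le1.
apply: le_trans (subset_prob_exists predT _ w01); apply: le_subset_prob => [|E]; first exact: w01.
by rewrite negb_forall.
Qed.

End TypicalGraph.

Section Sparse.
Variables (R : realType) (n : nat) (p q : R).
Implicit Types (E : {set {set vertex n}}) (S A B : {set vertex n}).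
Hypotheses (q0 : 0 <= q) (qp : q <= p) (p1 : p <= 1).
Hypotheses (n0 : (0 < n)%N) (m256 : 256 <= n%:R * p).

Let w01 := sbm_weight_01 (n := n) q0 qp p1.

(** If the set of heavy vertices is large, then it sends a number of edges to [B] that
    exceeds the mean by the factor [th / x], where [x] is the density of [B] and [th]
    the rate. For a set [S] this has probability at most [exp(- 2 c |S|)] with
    [exp(- c) <= x]. One half of the exponent pays for the union bound over [S], and the
    other, by [|S| >= th |B|] and [th c >= 8 ln (1 / x)], leaves enough for the union bound
    over [B]. *)
Lemma prob_heavy_large B : small_set R B ->
  subset_prob (@sbm_weight R n p q)
    (fun E => rate n p #|B| * #|B|%:R < #|heavy p E B|%:R) <=
  expR (- (8 * #|B|%:R * ln (n%:R / #|B|%:R)) + 2 * #|B|%:R).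
Proof.
move=> /andP[B0 Bx]; set b : R := #|B|%:R.
set N : R := n%:R; set m := N * p; set x := b / N in Bx.
have b0 : 0 < b by rewrite ltr0n.
have N0 : 0 < N by rewrite ltr0n.
have x0 : 0 < x by rewrite divr_gt0.
have m256' : 256 <= m by exact: m256.
have m0 : 0 < m by lra.
have p0 : 0 <= p by exact: le_trans qp.
rewrite -[rate _ _ _]/(infection_rate m x).
have th0 := infection_rate_gt0 m256' x0.
have th1 := infection_rate_le1 m256' Bx.
have th2 := infection_rate_sqr m256' x0.
have thl := infection_rate_ln m256' x0.
set th := infection_rate m x in th0 th1 th2 thl *.
set l := ln (N / b).
have xl : ln x = - l by rewrite /l /x -lnV ?posrE ?divr_gt0 // invf_div.
have l0 : 0 <= l by rewrite -[l]opprK -xl oppr_ge0 ln_le0 //; lra.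
set L := ln (th / x) in thl.
have Ll : l / 2 <= L - 1 by lra.
pose c := th * m * (L - 1) / 4.
have thc : 8 * l <= th * c.
  have : 64 * (l / 2) <= th ^+ 2 * m * (L - 1) by apply: ler_pM; lra.
  by rewrite /c expr2; lra.
have c0 : 0 <= c by rewrite divr_ge0 // mulr_ge0 ?(ltW (mulr_gt0 th0 m0)) //; lra.
have lc : l <= c.
  have : th * c <= c by rewrite ler_piMl.
  lra.
have one S : subset_prob (@sbm_weight R n p q)
    (fun E => th * m * #|S|%:R <= (edges E S B)%:R) <= expR (- c) ^+ (2 * #|S|).
  have eM : expected_edges p q S B <= #|S|%:R * b * p by exact: expected_edges_le.
  have L0 : 0 <= L / 2 by lra.
  apply: le_trans (edges_heavy q0 qp p1 (th * m * #|S|%:R) L0 eM) _.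
  rewrite -expRM_natl ler_expR mulrCA divff ?mulr1 //.
  rewrite /L lnK ?posrE ?divr_gt0 //.
  have -> : #|S|%:R * b * p / 2 * (th / x) = #|S|%:R * th * m / 2.
    by rewrite /x /m; field; rewrite !gt_eqF.
  rewrite -/L natrM /c; have : 0 <= #|S|%:R :> R by [].
  by move: (#|S|%:R : R) => s s0; lra.
apply: (@le_trans _ _ (\sum_(S : {set vertex n} | th * b <= #|S|%:R)
    subset_prob (@sbm_weight R n p q) (fun E => th * m * #|S|%:R <= (edges E S B)%:R))).
  apply: le_trans (subset_prob_exists _ _ w01); apply: le_subset_prob => [|E hE]; first exact: w01.
  apply/existsP; exists (heavy p E B); rewrite ltW //=.
  rewrite /edges natr_sum mulrC mulr_natl -sumr_const; apply: ler_sum => v.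
  by rewrite inE.
apply: (@le_trans _ _ (\sum_(S : {set vertex n}) expR (- (th * b * c)) * expR (- c) ^+ #|S|)).
  rewrite big_mkcond; apply: ler_sum => S _; case: ifP => [Sb|_]; last first.
    by rewrite mulr_ge0 ?exprn_ge0 ?expR_ge0.
  apply: le_trans (one S) _; rewrite mul2n -addnn exprD ler_wpM2r ?exprn_ge0 ?expR_ge0 //.
  by rewrite -expRM_natl ler_expR mulrN lerN2 ler_wpM2r.
rewrite -mulr_sumr; apply: le_trans (ler_wpM2l _ (sum_expr_card_le _ _)) _; rewrite ?expR_ge0 //.
rewrite -expRD ler_expR card_vertex natrM; apply: lerD.
  by have := ler_wpM2l (ltW b0) thc; lra.
have -> : 2 * b = x * (2 * N) by rewrite /x; field; rewrite gt_eqF.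
rewrite ler_wpM2r ?mulr_ge0 ?(ltW N0) //.
by rewrite -(lnK x0) ler_expR xl lerN2.
Qed.

Lemma card_fixed_size_le (k : nat) : (0 < k)%N ->
  #|[set B : {set vertex n} | #|B| == k]%SET|%:R <=
    expR (k%:R * ln (n%:R / k%:R) + 2 * k%:R) :> R.
Proof.
move=> k0; set x : R := k%:R / n%:R.
have x0 : 0 < x by rewrite divr_gt0 ?ltr0n.
have h := sum_expr_card_le (vertex n) (ltW x0).
have xk : 0 < x ^+ k by rewrite exprn_gt0.
rewrite -(ler_pM2r xk); apply: (@le_trans _ _ (\sum_(B : {set vertex n}) x ^+ #|B|)).
  rewrite mulr_natl -sumr_const big_mkcond [leRHS]big_mkcond /=; apply: ler_sum => B _.
  by rewrite inE; case: eqP => [->//|_]; rewrite exprn_ge0 // ltW.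
apply: le_trans h _; rewrite -{2}(lnK x0) -expRM_natl -expRD ler_expR.
have -> : ln x = - ln (n%:R / k%:R).
  by rewrite -lnV ?posrE ?divr_gt0 ?ltr0n // invf_div.
rewrite card_vertex natrM /x mulrCA divfK ?pnatr_eq0 -?lt0n //.
lra.
Qed.

(** By the two preceding lemmas, the sets of size [k] contribute at most
    [exp(- 3 k ln (n / k))], and [k ln (n / k) >= ln n]. *)
Lemma prob_not_sparse :
  subset_prob (@sbm_weight R n p q) (fun E => ~~ sparse p E) <= 3 * n%:R^-1.
Proof.
set N : R := n%:R; have N0 : 0 < N by rewrite ltr0n.
pose F (k : nat) := expR (- (8 * k%:R * ln (N / k%:R)) + 2 * k%:R).
apply: (@le_trans _ _ (\sum_(B : {set vertex n} | small_set R B) F #|B|)).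
  apply: (@le_trans _ _ (\sum_(B : {set vertex n} | small_set R B)
    subset_prob (@sbm_weight R n p q)
    (fun E => rate n p #|B| * #|B|%:R < #|heavy p E B|%:R))); last first.
    by apply: ler_sum => B; exact: prob_heavy_large.
  apply: le_trans (subset_prob_exists _ _ w01); apply: le_subset_prob => [|E]; first exact: w01.
  rewrite negb_forall => /existsP[B]; rewrite negb_imply -ltNge => h.
  by apply/existsP; exists B.
have cardB B : (#|B| < (2 * n).+1)%N by rewrite ltnS -card_vertex max_card.
rewrite (partition_big (fun B => Ordinal (cardB B)) predT) //=.
apply: (@le_trans _ _ (\sum_(k < (2 * n).+1) expR (- ln N) ^+ 3)).
  apply: ler_sum => k _.
  have [/existsP[B /andP[Bs /eqP kB]]|/existsPn h] :=
    boolP [exists B : {set vertex n}, small_set R B && (Ordinal (cardB B) == k)]; last first.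
    rewrite big1 ?exprn_ge0 ?expR_ge0 // => B hB.
    by have := h B; rewrite hB.
  have kE : #|B| = k by rewrite -kB.
  move: Bs; rewrite /small_set kE => /andP[k0 kx].
  apply: (@le_trans _ _ (#|[set B : {set vertex n} | #|B| == k]%SET|%:R * F k)).
    rewrite mulr_natl -sumr_const big_mkcond [leRHS]big_mkcond /=; apply: ler_sum => C _.
    rewrite inE -val_eqE /=; case: eqP => [->|_]; last by rewrite andbF.
    by rewrite andbT; case: ifP => _ //; exact: expR_ge0.
  apply: le_trans (ler_wpM2r _ (card_fixed_size_le k0)) _; first exact: expR_ge0.
  rewrite /F -expRD -expRM_natl ler_expR -/N.
  have kk : 1 <= k%:R :> R by rewrite ler1n.
  have l1 : 1 <= ln (N / k%:R).
    rewrite -[leLHS]expRK ler_ln ?posrE ?expR_gt0 ?divr_gt0 //; last lra.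
    apply: le_trans (expR1_le4 R) _.
    have k00 : 0 < k%:R :> R by exact: lt_le_trans kk.
    rewrite ler_pdivlMr //; move: kx; rewrite ler_pdivrMr //.
    lra.
  have := ln_le_mul_ln_div kk N0 l1.
  have : k%:R * 1 <= k%:R * ln (N / k%:R) by rewrite ler_wpM2l.
  lra.
rewrite sumr_const card_ord -[leLHS]mulr_natl expR_lnN // -/N.
have N1 : 1 <= N by rewrite ler1n.
have Ni1 : N^-1 <= 1 by rewrite invf_le1.
have Ni0 : 0 < N^-1 by rewrite invr_gt0.
rewrite exprS mulrCA [3 * _]mulrC ler_wpM2l ?(ltW Ni0) //.
rewrite -natr1 natrM -/N expr2 mulrA mulrDl -[2 * N / N]mulrA divff ?gt_eqF // mulr1 mul1r.
have : (2 + N^-1) * N^-1 <= 3 * 1 by apply: ler_pM; lra.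
lra.
Qed.

End Sparse.

(** * One step from a minority *)

Section OneStep.
Variables (R : realType) (V : finType) (E : {set {set V}}).
Implicit Types (S A B : {set V}) (v : V).

Definition nbr_ratio A v : R := #|nbrs E v :&: A|%:R / #|nbrs E v|%:R.

Lemma nbr_ratio_01 A v : 0 <= nbr_ratio A v <= 1.
Proof.
rewrite /nbr_ratio divr_ge0 //=; have [->|N0] := eqVneq (#|nbrs E v|%:R : R) 0.
  by rewrite invr0 mulr0.
have Np : 0 < #|nbrs E v|%:R :> R by rewrite lt0r N0 ler0n.
by rewrite ler_pdivrMr // mul1r ler_nat subset_leq_card ?finset.subsetIl.
Qed.

(** Also true for isolated vertices, where both sides vanish; this makes it
    unnecessary to set them apart in [mean_step]. *)
Lemma nbr_ratioM A v : nbr_ratio A v * #|nbrs E v|%:R = #|nbrs E v :&: A|%:R.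
Proof.
have [/eqP|N0] := eqVneq (#|nbrs E v|%:R : R) 0; last by rewrite divfK.
rewrite pnatr_eq0 => /eqP N0; rewrite N0 mulr0; apply/esym/eqP.
by rewrite pnatr_eq0 -leqn0 -N0 subset_leq_card ?finset.subsetIl.
Qed.

Lemma adopt_prob_maj A v : adopt_prob R E A v = (1 + maj (2 * nbr_ratio A v - 1)) / 2.
Proof. by rewrite adopt_probE -/(nbr_ratio A v) /maj; field. Qed.

Lemma edgesC S A : edges E S A = edges E A S.
Proof.
rewrite /edges; under eq_bigr do rewrite card_nbrsI.
rewrite exchange_big; apply: eq_bigr => u _; rewrite card_nbrsI.
by apply: eq_bigr => v _; rewrite finset.setUC.
Qed.

(** The majority of three inverts with the opinions. An isolated vertex would get
    opinion 2 in either case. *)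
Lemma adopt_probC A v : (0 < #|nbrs E v|)%N ->
  adopt_prob R E (~: A)%SET v = 1 - adopt_prob R E A v.
Proof.
move=> v0; rewrite !adopt_prob_maj.
have -> : nbr_ratio (~: A)%SET v = 1 - nbr_ratio A v.
  have N0 : (#|nbrs E v|%:R : R) != 0 by rewrite pnatr_eq0 -lt0n.
  apply: (mulIf N0); rewrite mulrBl !nbr_ratioM mul1r.
  by rewrite -[in RHS](cardsID A (nbrs E v)) natrD addrAC subrr add0r finset.setDE.
by rewrite /maj; field.
Qed.

Lemma bo3_stepC A B : (forall v, (0 < #|nbrs E v|)%N) ->
  bo3_step R E (~: A)%SET (~: B)%SET = bo3_step R E A B.
Proof.
move=> v0; apply: eq_bigr => v _; rewrite finset.in_setC adopt_probC //.
by case: (v \in B); rewrite //= opprB addrC subrK.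
Qed.

Lemma consensusbC A : consensusb (~: A)%SET = consensusb A.
Proof.
rewrite /consensusb orbC; congr orb.
  by rewrite -finset.setC0 (inj_eq (@finset.setC_inj _)).
by rewrite -finset.setCT (inj_eq (@finset.setC_inj _)).
Qed.

Lemma survivalC k A : (forall v, (0 < #|nbrs E v|)%N) ->
  survival R E k (~: A)%SET = survival R E k A.
Proof.
move=> v0; elim: k A => [|k IH] A /=; rewrite consensusbC //.
case: ifP => // _; rewrite (reindex_inj (@finset.setC_inj V)) /=.
by apply: eq_bigr => B _; rewrite bo3_stepC // IH.
Qed.

Lemma prob_step_card_large A (mu L : R) : \sum_v adopt_prob R E A v <= mu ->
  subset_prob (adopt_prob R E A) (fun B => 2 * mu + 2 * L <= #|B|%:R) <= expR (- L).
Proof.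
move=> amu; have a01 := adopt_prob_01 R E A.
have h : expR (1 / 2) <= 2 :> R.
  by apply: le_trans (expR_le_inv _) _; [lra|rewrite invf_ple ?posrE; lra].
apply: le_trans (_ : _ <= expR (\sum_v adopt_prob R E A v * (expR (1 / 2) - 1) - (mu + L))) _.
  apply: le_trans (chernoff _ _ a01); apply: le_subset_prob => // B.
  by rewrite sumr_const -mulr_natl; lra.
rewrite ler_expR -mulr_suml.
have s0 : 0 <= \sum_v adopt_prob R E A v.
  by apply: sumr_ge0 => v _; have /andP[] := a01 v.
by have := ler_wpM2l s0 h; lra.
Qed.

End OneStep.

Section MinorityDrift.
Variables (R : realType) (n : nat) (p : R) (E : {set {set vertex n}}).
Implicit Types (A B : {set vertex n}).
Hypotheses (m0 : 0 < n%:R * p) (regE : regular_degrees p E) (spE : sparse p E).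

Lemma regular_nbrs_gt0 v : (0 < #|nbrs E v|)%N.
Proof.
have /andP[lo _] := forallP regE v; rewrite -(ltr0n R).
by apply: lt_le_trans lo; rewrite divr_gt0.
Qed.

(** A vertex with few neighbours in [B] contributes little more than its share
    of the edges at [B]; the others are few by sparsity. *)
Lemma minority_drift B : small_set R B ->
  \sum_v adopt_prob R E B v <= 37 * rate n p #|B| * #|B|%:R.
Proof.
move=> Bs; set th := rate n p #|B|; set m := n%:R * p.
have th0 : 0 <= th by rewrite mulr_ge0 // addr_ge0 ?invr_ge0 ?sqrtr_ge0.
have m0' : 0 < m by exact: m0.
apply: (@le_trans _ _ (\sum_v ((v \in heavy p E B)%:R +
    12 * th / m * #|nbrs E v :&: B|%:R))).
  apply: ler_sum => v _.
  have /andP[a0 a1] := adopt_prob_01 R E B v.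
  have dB0 : 0 <= #|nbrs E v :&: B|%:R :> R by [].
  have c0 : 0 <= 12 * th / m by rewrite divr_ge0 ?(ltW m0') // mulr_ge0.
  have [_|] := boolP (v \in heavy p E B).
    by rewrite /= -[leLHS]addr0 lerD // mulr_ge0.
  rewrite inE -ltNge -/th -/m /= add0r => dth.
  have /andP[x0 x1] := nbr_ratio_01 R E B v.
  have /andP[lo _] := forallP regE v.
  rewrite -/m in lo.
  rewrite adopt_probE -/(nbr_ratio R E B v); set x := nbr_ratio R E B v in x0 x1 *.
  have xm : x * (m / 2) <= #|nbrs E v :&: B|%:R by rewrite -nbr_ratioM ler_wpM2l.
  apply: (@le_trans _ _ (3 * x ^+ 2)); first by rewrite gerBl mulr_ge0 ?exprn_ge0.
  rewrite mulrAC ler_pdivlMr //.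
  have : (x * (m / 2)) * (x * (m / 2)) <= (th * m) * #|nbrs E v :&: B|%:R.
    have xm0 : 0 <= x * (m / 2) by rewrite mulr_ge0 // divr_ge0 // ltW.
    by apply: ler_pM => //; apply: le_trans xm (ltW dth).
  have -> : x * (m / 2) * (x * (m / 2)) = m * (x ^+ 2 * m / 4) by field.
  have -> : th * m * #|nbrs E v :&: B|%:R = m * (th * #|nbrs E v :&: B|%:R) by ring.
  by rewrite ler_pM2l //; lra.
rewrite big_split /= -mulr_sumr.
have -> : \sum_v (v \in heavy p E B)%:R = #|heavy p E B|%:R :> R.
  by rewrite -sum1_card natr_sum [RHS]big_mkcond; apply: eq_bigr => v _; case: ifP.
have -> : \sum_v #|nbrs E v :&: B|%:R = (edges E B [set: vertex n]%SET)%:R :> R.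
  rewrite edgesC /edges natr_sum; apply: eq_bigl => v; by rewrite inE.
have hv : #|heavy p E B|%:R <= th * #|B|%:R.
  by have /implyP := forallP spE B; exact.
have deg : (edges E B [set: vertex n]%SET)%:R <= 3 * m * #|B|%:R.
  rewrite /edges natr_sum mulr_natr -sumr_const; apply: ler_sum => v _.
  by rewrite finset.setIT; have /andP[] := forallP regE v.
have c0 : 0 <= 12 * th / m by rewrite divr_ge0 ?(ltW m0') // mulr_ge0.
apply: le_trans (lerD hv (ler_wpM2l c0 deg)) _.
have -> : 12 * th / m * (3 * m * #|B|%:R) = 36 * th * #|B|%:R.
  by field; rewrite gt_eqF.
lra.
Qed.

End MinorityDrift.

(** * One step near the mean-field map *)

Lemma sum_norm_le (R : realType) (T : finType) (F : T -> R) (t : R) (D : {set T}) :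
  (forall S : {set T}, `|\sum_(v in S) F v| <= t) ->
  \sum_(v in D) `|F v| <= 2 * t.
Proof.
move=> Ft; rewrite (bigID (fun v => 0 <= F v)) /=.
have -> : 2 * t = t + t by ring.
apply: lerD.
  have -> : \sum_(v in D | 0 <= F v) `|F v| = \sum_(v in [set v in D | 0 <= F v]%SET) F v.
    by apply: eq_big => v; rewrite ?inE // => /andP[_ /ger0_norm].
  by apply: le_trans (ler_norm _) (Ft _).
have -> : \sum_(v in D | ~~ (0 <= F v)) `|F v| = - \sum_(v in [set v in D | ~~ (0 <= F v)]%SET) F v.
  rewrite -sumrN; apply: eq_big => v; rewrite ?inE // => /andP[_].
  by rewrite -ltNge => /ltr0_norm.
by apply: le_trans (ler_norm _) _; rewrite normrN.
Qed.

Section MeanField.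
Variables (R : realType) (n : nat) (p r : R).
Implicit Types (A B S : {set vertex n}) (v u : vertex n) (b : bool).

Definition block b : {set vertex n} := [set v | v.1 == b]%SET.

Definition density A b : R := #|A :&: block b|%:R / n%:R.

Definition coords A : R * R :=
  (density A true + density A false - 1, density A true - density A false).

Definition close (x y : R * R) (e : R) : bool :=
  (`|x.1 - y.1| <= e) && (`|x.2 - y.2| <= e).

Lemma card_block b : #|block b| = n.
Proof.
rewrite -[RHS]card_ord -(card_imset _ (_ : injective (fun i : 'I_n => (b, i)))).
  apply: eq_card => -[c i]; rewrite inE /=; apply/eqP/imsetP => [->|[j _ [-> _]] //].
  by exists i.
by move=> i j [].
Qed.

Hypotheses (n0 : (0 < n)%N).
Let N0 : 0 < n%:R :> R. Proof. by rewrite ltr0n. Qed.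

Lemma card_density A b : #|A :&: block b|%:R = n%:R * density A b.
Proof. by rewrite /density mulrC divfK // gt_eqF. Qed.

Lemma density_01 A b : 0 <= density A b <= 1.
Proof.
rewrite /density divr_ge0 //= ler_pdivrMr // mul1r ler_nat -[leqRHS](card_block b).
by rewrite subset_leq_card // finset.subsetIr.
Qed.

Lemma coords_in_diamond A : in_diamond (coords A).
Proof.
have /andP[? ?] := density_01 A true; have /andP[? ?] := density_01 A false.
rewrite /in_diamond /=.
case: (ger0P (_ - 1)) => ?; case: (ger0P (_ - density A false)) => ?; lra.
Qed.

Lemma coords1E A : (coords A).1 = #|A|%:R / n%:R - 1.
Proof.
rewrite /= /density -mulrDl -natrD; congr (_%:R / _ - 1).
rewrite -(cardsID (block true) A); congr addn; apply: eq_card => v.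
by rewrite !inE andbC; case: (v.1).
Qed.

(** The fraction of neighbours with opinion 1 that a vertex of block [b] expects. *)
Definition majority_density A b : R := (density A b + r * density A (~~ b)) / (1 + r).

Hypotheses (r0 : 0 <= r) (p0 : 0 < p).
Let r1 : 0 < 1 + r. Proof. by rewrite ltr_pwDl. Qed.

Lemma majority_density_01 A b : 0 <= majority_density A b <= 1.
Proof.
have /andP[d0 d1] := density_01 A b; have /andP[e0 e1] := density_01 A (~~ b).
rewrite /majority_density divr_ge0 ?(ltW r1) ?addr_ge0 ?mulr_ge0 //=.
by rewrite ler_pdivrMr // mul1r lerD // ler_piMr.
Qed.

Lemma sum_pair_prob A v :
  \sum_(u in A) pair_prob p (r * p) v u =
  n%:R * p * ((1 + r) * majority_density A v.1).
Proof.
rewrite /majority_density [(1 + r) * _]mulrC divfK ?gt_eqF //.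
rewrite (bigID (fun u => u \in block v.1)) /=.
have -> : \sum_(u in A | u \in block v.1) pair_prob p (r * p) v u =
    #|A :&: block v.1|%:R * p.
  rewrite mulr_natl -sumr_const; apply: eq_big => u; first by rewrite !inE.
  by rewrite !inE /pair_prob eq_sym => /andP[_ ->].
have -> : \sum_(u in A | u \notin block v.1) pair_prob p (r * p) v u =
    #|A :&: block (~~ v.1)|%:R * (r * p).
  rewrite mulr_natl -sumr_const; apply: eq_big => u.
    by rewrite !inE; case: (v.1); case: (u.1).
  by rewrite !inE /pair_prob eq_sym => /andP[_ /negPf ->].
by rewrite !card_density; ring.
Qed.

Variables (E : {set {set vertex n}}) (eps : R).
Hypothesis (discE : low_discrepancy p (r * p) eps E).

Lemma sum_nbrs_dev A b :
  \sum_(v in block b) `|#|nbrs E v :&: A|%:R -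
     n%:R * p * ((1 + r) * majority_density A b)| <= 2 * (eps * (n%:R ^+ 2 * p)).
Proof.
apply: le_trans (sum_norm_le (F := fun v => #|nbrs E v :&: A|%:R -
  n%:R * p * ((1 + r) * majority_density A v.1)) (block b) _).
  by apply: ler_sum => v; rewrite inE => /eqP ->.
move=> S; have /forallP/(_ S)/forallP/(_ A) := discE.
rewrite /edges natr_sum /expected_edges -sumrB.
by under eq_bigr do rewrite sum_pair_prob.
Qed.

(** With [x] the fraction of neighbours of [v] in [A], [y] its expected value and [D] the
    expected degree, [D (x - y)] is the deviation of the number of neighbours in [A]
    minus [x] times the deviation of the degree. Summed over the block, both are
    controlled by the discrepancy, although single vertices are not. *)
Lemma mean_step A b :
  `|\sum_(v in block b) adopt_prob R E A v -
    n%:R * ((1 + maj (2 * majority_density A b - 1)) / 2)| <= 6 * eps * n%:R.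
Proof.
set y := majority_density A b; set D := n%:R * p * (1 + r).
have D0 : 0 < D by rewrite !mulr_gt0.
have /andP[y0 y1] := majority_density_01 A b; rewrite -/y in y0 y1.
have e0 : 0 <= eps * (n%:R ^+ 2 * p).
  have := sum_nbrs_dev A b.
  have : 0 <= \sum_(v in block b) `|#|nbrs E v :&: A|%:R - n%:R * p * ((1 + r) * majority_density A b)|.
    by apply: sumr_ge0.
  by lra.
have dT : majority_density [set: vertex n]%SET b = 1.
  rewrite /majority_density /density !finset.setTI !card_block.
  by field; rewrite !gt_eqF.
have -> : n%:R * ((1 + maj (2 * y - 1)) / 2) =
    \sum_(v in block b) (1 + maj (2 * y - 1)) / 2 :> R.
  by rewrite sumr_const card_block mulr_natl.
rewrite -sumrB; apply: le_trans (ler_norm_sum _ _ _) _.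
apply: le_trans (_ : _ <= \sum_(v in block b) 3 / 2 / D *
   (`|#|nbrs E v :&: [set: vertex n]%SET|%:R - n%:R * p * ((1 + r) * 1)| +
    `|#|nbrs E v :&: A|%:R - n%:R * p * ((1 + r) * y)|)) _.
  apply: ler_sum => v _.
  rewrite adopt_prob_maj; set x := nbr_ratio R E A v.
  have /andP[x0 x1] : 0 <= x <= 1 by exact: nbr_ratio_01.
  have -> : (1 + maj (2 * x - 1)) / 2 - (1 + maj (2 * y - 1)) / 2 =
    (maj (2 * x - 1) - maj (2 * y - 1)) / 2 by ring.
  rewrite normrM [X in _ * X]gtr0_norm ?invr_gt0 //.
  have h1 : `|maj (2 * x - 1) - maj (2 * y - 1)| <= 3 * `|x - y|.
    apply: le_trans (maj_lip _ _) _; [lra|lra|].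
    rewrite (_ : 2 * x - 1 - (2 * y - 1) = 2 * (x - y)); last by ring.
    by rewrite normrM ger0_norm //; lra.
  suff : D * `|x - y| <= `|#|nbrs E v :&: [set: vertex n]%SET|%:R - n%:R * p * ((1 + r) * 1)| +
    `|#|nbrs E v :&: A|%:R - n%:R * p * ((1 + r) * y)|.
    rewrite mulrC -ler_pdivlMr // => h2.
    rewrite (_ : 3 / 2 / D * _ = 3 / 2 * ((`|#|nbrs E v :&: [set: vertex n]%SET|%:R - n%:R * p * ((1 + r) * 1)| +
    `|#|nbrs E v :&: A|%:R - n%:R * p * ((1 + r) * y)|) / D)); last by ring.
    lra.
  rewrite finset.setIT -nbr_ratioM -/x -{1}(ger0_norm (ltW D0)) -normrM.
  rewrite (_ : D * (x - y) = (x * #|nbrs E v|%:R - n%:R * p * ((1 + r) * y)) -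
     x * (#|nbrs E v|%:R - n%:R * p * ((1 + r) * 1))); last by rewrite /D; ring.
  apply: le_trans (ler_normB _ _) _; rewrite addrC lerD2r normrM (ger0_norm x0).
  by rewrite ler_piMl.
rewrite -mulr_sumr big_split /=.
have := sum_nbrs_dev [set: vertex n]%SET b; rewrite dT => hT.
have hA := sum_nbrs_dev A b; rewrite -/y in hA.
apply: (@le_trans _ _ (3 / 2 / D * (4 * (eps * (n%:R ^+ 2 * p))))).
  by apply: ler_wpM2l; [rewrite !divr_ge0 // ltW|lra].
rewrite mulrAC ler_pdivrMr // (_ : 6 * eps * n%:R * D = 6 * (eps * (n%:R ^+ 2 * p)) * (1 + r)); last first.
  by rewrite /D; ring.
have : 0 <= eps * (n%:R ^+ 2 * p) * r by rewrite mulr_ge0.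
lra.
Qed.

Lemma block_step_dev A b : 0 < eps <= 1 ->
  subset_prob (adopt_prob R E A) (fun B =>
     eps * n%:R < `|#|B :&: block b|%:R - \sum_(v in block b) adopt_prob R E A v|)
  <= 2 * expR (- (eps ^+ 2 * n%:R / 8)).
Proof.
move=> /andP[e0 e1]; have a01 := adopt_prob_01 R E A.
pose w (c : R) v : R := if v \in block b then c else 0.
have wB c B : \sum_(v in B) w c v = c * #|B :&: block b|%:R.
  rewrite mulr_natr -sumr_const big_mkcond [RHS]big_mkcond /=.
  by apply: eq_bigr => v _; rewrite /w finset.in_setI; case: (v \in B).
have wa c : \sum_v adopt_prob R E A v * w c v = c * \sum_(v in block b) adopt_prob R E A v.
  rewrite mulr_sumr [RHS]big_mkcond /=; apply: eq_bigr => v _.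
  by rewrite /w; case: ifP; rewrite ?mulr0 // mulrC.
have dev c : c ^+ 2 = 1 -> c <= 1 -> subset_prob (adopt_prob R E A) (fun B =>
     c * (\sum_(v in block b) adopt_prob R E A v) + eps * n%:R <= c * #|B :&: block b|%:R)
  <= expR (- (eps ^+ 2 * n%:R / 8)).
  move=> c2 c1.
  have l0 : 0 <= eps / 4 by lra.
  have lw v : eps / 4 * w c v <= 1 / 2.
    rewrite /w; case: ifP => _; last lra.
    by apply: le_trans (_ : eps / 4 * 1 <= _); [rewrite ler_wpM2l|lra].
  have var : \sum_v adopt_prob R E A v * w c v ^+ 2 <= n%:R.
    rewrite -[leRHS](_ : \sum_(v in block b) (1 : R) = _); last first.
      by rewrite sumr_const card_block.
    rewrite [leRHS]big_mkcond /=; apply: ler_sum => v _; rewrite /w; case: ifP => _.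
      by rewrite c2 mulr1; have /andP[] := a01 v.
    by rewrite expr0n mulr0.
  apply: le_trans (_ : _ <= expR (2 * (eps / 4) ^+ 2 * n%:R - eps / 4 * (eps * n%:R))) _.
    apply: le_trans (chernoff_dev (eps * n%:R) a01 l0 lw var).
    by apply: le_subset_prob => // B; rewrite wa wB.
  by rewrite ler_expR (_ : _ - _ = - (eps ^+ 2 * n%:R / 8)) //; field.
have h1 := dev 1 (expr1n _ _) (lexx _).
have h2 := dev (-1) _ _.
rewrite [leRHS]mulr_natl [leRHS]mulr2n.
apply: le_trans (lerD h1 (h2 _ _)); [|by rewrite sqrrN expr1n|by lra].
apply: le_trans (subset_probU _ _ a01); apply: le_subset_prob => // B.
by rewrite ltNge ler_norml negb_and -!ltNge => /orP[] h; apply/orP; [right|left]; lra.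
Qed.

(** One step follows the mean-field map, up to an exponentially small
    probability, from every starting set. *)
Lemma coords_step A : 0 < eps <= 1 ->
  subset_prob (adopt_prob R E A) (fun B =>
     ~~ close (coords B) (flow ((1 - r) / (1 + r)) (coords A)) (14 * eps))
  <= 4 * expR (- (eps ^+ 2 * n%:R / 8)).
Proof.
move=> e01; have a01 := adopt_prob_01 R E A.
rewrite (_ : 4 * _ = 2 * expR (- (eps ^+ 2 * n%:R / 8)) + 2 * expR (- (eps ^+ 2 * n%:R / 8))); last by ring.
apply: le_trans (lerD (block_step_dev A true e01) (block_step_dev A false e01)).
apply: le_trans (subset_probU _ _ a01); apply: le_subset_prob => // B.
apply: contraNT; rewrite negb_or -!leNgt => /andP[hT hF].
have dens b : `|#|B :&: block b|%:R - \sum_(v in block b) adopt_prob R E A v| <= eps * n%:R ->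
  `|density B b - (1 + maj (2 * majority_density A b - 1)) / 2| <= 7 * eps.
  move=> h; rewrite -(ler_pM2r N0) -{1}(gtr0_norm N0) -normrM mulrBl.
  have := mean_step A b; rewrite card_density in h.
  rewrite [density _ _ * _]mulrC [_ / 2 * _]mulrC; move: h.
  by rewrite !ler_norml => /andP[? ?] /andP[? ?]; apply/andP; split; lra.
have := dens _ hT; have := dens _ hF.
have -> : 2 * majority_density A true - 1 =
   (coords A).1 + (1 - r) / (1 + r) * (coords A).2.
  by rewrite /majority_density /=; field; rewrite gt_eqF.
have -> : 2 * majority_density A false - 1 =
   (coords A).1 - (1 - r) / (1 + r) * (coords A).2.
  by rewrite /majority_density /=; field; rewrite gt_eqF.
rewrite /close /flow /=; move: (maj _) (maj _) => a c.
by rewrite !ler_norml => /andP[? ?] /andP[? ?]; apply/andP; split; apply/andP; split; lra.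
Qed.

End MeanField.

(** * From imbalance to consensus *)

Section PseudoOrbit.
Variables (R : realType) (n : nat) (p r eps : R) (E : {set {set vertex n}}).
Hypotheses (n0 : (0 < n)%N) (r01 : 0 <= r <= 1) (p0 : 0 < p) (e01 : 0 < eps <= 1).
Hypothesis (discE : low_discrepancy p (r * p) eps E).
Implicit Types (A B : {set vertex n}).

Definition drift_ratio : R := (1 - r) / (1 + r).

Lemma drift_ratio_01 : 0 <= drift_ratio <= 1.
Proof.
have /andP[r0 r1] := r01; rewrite /drift_ratio; apply/andP; split.
  by rewrite divr_ge0 //; lra.
by rewrite ler_pdivrMr; lra.
Qed.

(** The map expands distances at most by the factor 3, so that the errors of the
    single steps add up to at most [14 eps 4^M] after [M] steps. *)
Lemma survival_pseudo_orbit M k (kappa eta c : R) A : 0 <= c ->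
  (forall x, in_diamond x -> kappa <= `|x.1| ->
     1 - eta <= `|(iter M (flow drift_ratio) x).1|) ->
  (forall B, 1 - eta - 14 * eps * 4 ^+ M <= `|(coords R B).1| ->
     survival R E k B <= c) ->
  kappa <= `|(coords R A).1| ->
  survival R E (M + k) A <= M%:R * (4 * expR (- (eps ^+ 2 * n%:R / 8))) + c.
Proof.
move=> c0 orbit final Ak; have /andP[e0 e1] := e01; have /andP[r0 r1] := r01.
pose G i B := `[< exists x, [/\ in_diamond x, kappa <= `|x.1| &
  close (coords R B) (iter i (flow drift_ratio) x) (14 * eps * 4 ^+ i)] >].
apply: (survival_chain_le (G := G)) => //.
- move=> i B iM ncB /asboolP[x [xd xk xn]].
  apply: le_trans (coords_step n0 r0 p0 discE B e01).
  apply: le_subset_prob => [|B']; first exact: adopt_prob_01.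
  apply: contraNN => /andP[h1 h2]; apply/asboolP; exists x; split=> //.
  have /andP[xn1 xn2] := xn.
  have [g1 g2] := flow_lip drift_ratio_01 (coords_in_diamond R n0 B)
     (iter_flow_in_diamond drift_ratio_01 i xd) xn1 xn2.
  have e4 : 1 <= 4 ^+ i :> R by rewrite exprn_ege1 // ler1n.
  have e4' : eps * 1 <= eps * 4 ^+ i by rewrite ler_wpM2l // ltW.
  rewrite -/drift_ratio in h1 h2; rewrite iterS exprS.
  apply/andP; split.
    apply: le_trans (ler_distD (flow drift_ratio (coords R B)).1 _ _) _; lra.
  apply: le_trans (ler_distD (flow drift_ratio (coords R B)).2 _ _) _; lra.
- move=> B ncB /asboolP[x [xd xk /andP[xn _]]]; apply: final.
  have := orbit x xd xk.
  have := ler_normB (coords R B).1 ((coords R B).1 - (iter M (flow drift_ratio) x).1).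
  by rewrite subKr; lra.
- apply/asboolP; exists (coords R A); split=> //; first exact: coords_in_diamond.
  by rewrite /close /= !subrr normr0 expr0 mulr1 mulr_ge0 // ltW.
Qed.

End PseudoOrbit.

Section Minority.
Variables (R : realType) (n : nat) (p w : R) (E : {set {set vertex n}}).
Implicit Types (A B : {set vertex n}).
Local Notation m := (n%:R * p).
Local Notation N := (n%:R : R).

Hypotheses (n0 : (0 < n)%N) (p1 : p <= 1) (m0 : 0 < m).
Hypotheses (regE : regular_degrees p E) (spE : sparse p E).

(** This is [m^(-1/8)]; the powers of [m] that occur below are powers of it. *)
Definition decay : R := expR (- (ln m / 8)).

Let z := decay.
Hypotheses (w0 : 0 < w) (w_small : w <= 1 / 2048) (z_small : z <= w).

Let h : R := ln N / 2.
Let a : R := ln m / 4.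

(** Sizes on a logarithmic scale. The factor [w ^+ 2], of the order of the density at
    which the minority phase starts, absorbs the constant of [minority_drift]. *)
Definition minority_size (L : R) : R := N * w ^+ 2 * expR (- L).

Hypothesis log_small : 6 * ln N <= minority_size h.

Let N0 : 0 < N. Proof. by rewrite ltr0n. Qed.
Let z0 : 0 < z. Proof. exact: expR_gt0. Qed.
Let c20 : 0 < w ^+ 2. Proof. exact: exprn_gt0. Qed.

Let sqrt_m : (Num.sqrt m)^-1 = z ^+ 4.
Proof.
rewrite -(@expR_lnN _ (Num.sqrt m)) ?sqrtr_gt0 // -expRM_natl; congr expR.
have mE : m = Num.sqrt m ^+ 2 by rewrite sqr_sqrtr // ltW.
have -> : ln m = 2 * ln (Num.sqrt m) by rewrite {1}mE lnXn ?sqrtr_gt0 // [RHS]mulr_natl.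
by field.
Qed.

Lemma minority_size_gt0 L : 0 < minority_size L.
Proof. by rewrite mulr_gt0 ?expR_gt0 // mulr_gt0. Qed.

Lemma minority_size_anti L L' : L <= L' -> minority_size L' <= minority_size L.
Proof. by move=> LL; rewrite ler_wpM2l ?ler_expR ?lerN2 // ltW // mulr_gt0. Qed.

Lemma minority_small L B : 0 <= L -> ~~ consensusb B ->
  #|B|%:R <= minority_size L -> small_set R B.
Proof.
move=> L0 ncB BL; apply/andP; split.
  by rewrite card_gt0; apply: contraNneq ncB => ->; rewrite /consensusb eqxx.
rewrite ler_pdivrMr //; apply: le_trans BL _.
rewrite /minority_size (_ : N * w ^+ 2 * expR (- L) = expR (- L) * w ^+ 2 * N) ?ler_pM2r //; last by ring.
apply: (@le_trans _ _ (1 * w ^+ 2)).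
  by rewrite ler_wpM2r ?(ltW c20) // -expR0 ler_expR oppr_le0.
have : w * w <= w * 1 by rewrite ler_wpM2l ?(ltW w0) //; have := w_small; lra.
by have := w_small; rewrite mul1r expr2; lra.
Qed.

Lemma minority_drift_le L B : 0 <= L -> ~~ consensusb B ->
  #|B|%:R <= minority_size L ->
  \sum_v adopt_prob R E B v <= 296 * (expR (- (L / 2)) * w + z ^+ 4) * #|B|%:R.
Proof.
move=> L0 ncB BL.
apply: le_trans (minority_drift m0 regE spE (minority_small L0 ncB BL)) _.
rewrite ler_wpM2r // /rate /infection_rate sqrt_m mulrA.
rewrite (_ : 37 * 8 = 296 :> R); last by rewrite -natrM.
apply: ler_wpM2l; first exact: ler0n.
rewrite lerD2r.
rewrite -[leRHS]ger0_norm ?mulr_ge0 ?expR_ge0 ?(ltW w0) // -sqrtr_sqr ler_wsqrtr //.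
rewrite ler_pdivrMr //; apply: le_trans BL _.
rewrite /minority_size.
have -> : expR (- L) = expR (- (L / 2)) ^+ 2.
  by rewrite -expRM_natl; congr expR; field.
rewrite exprMn.
by rewrite le_eqVlt; apply/orP; left; apply/eqP; ring.
Qed.

(** A density [x] becomes [x^(3/2)] or [m^(-1/4) x], whichever is larger, until the size
    is about [sqrt n] and the fluctuations take over. *)
Definition next_exponent (L : R) : R := Num.min (3 / 2 * L) (Num.min (L + a) h).

(** Twice the expected size, plus a logarithm, splits into three terms; each is
    at most a third of the size allowed by one of the three arguments of the minimum. *)
Lemma minority_step L B : 0 <= L -> ~~ consensusb B ->
  #|B|%:R <= minority_size L ->
  subset_prob (adopt_prob R E B)
    (fun B' => ~~ (#|B'|%:R <= minority_size (next_exponent L))) <= N^-1.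
Proof.
move=> L0 ncB BL; set L' := next_exponent L.
pose c := 296 * (expR (- (L / 2)) * w + z ^+ 4); pose mu := c * minority_size L.
have c0 : 0 <= c.
  apply: mulr_ge0; first exact: ler0n.
  by apply: addr_ge0; [apply: mulr_ge0; [exact: expR_ge0|exact: ltW]|exact/exprn_ge0/ltW].
have mu_ge : \sum_v adopt_prob R E B v <= mu.
  exact: le_trans (minority_drift_le L0 ncB BL) (ler_wpM2l c0 BL).
rewrite -(expR_lnN N0).
apply: le_trans (prob_step_card_large (ln N) mu_ge); apply: le_subset_prob => [|B'].
  exact: adopt_prob_01.
rewrite -ltNge => /ltW; apply: le_trans.
have h1 : minority_size L * expR (- (L / 2)) <= minority_size L'.
  have -> : minority_size L * expR (- (L / 2)) = minority_size (3 / 2 * L).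
    by rewrite /minority_size -mulrA -expRD; congr (_ * expR _); field.
  by apply: minority_size_anti; rewrite ge_min lexx.
have h2 : minority_size L * z ^+ 2 <= minority_size L'.
  have -> : minority_size L * z ^+ 2 = minority_size (L + a).
    by rewrite /minority_size -mulrA -expRM_natl -expRD; congr (_ * expR _); rewrite /a; field.
  by apply: minority_size_anti; rewrite !ge_min lexx orbT.
have h3 : 6 * ln N <= minority_size L'.
  by apply: le_trans log_small _; rewrite minority_size_anti // !ge_min lexx !orbT.
have z1 : z <= 1 by have := w_small; have := z_small; lra.
have z2 : z ^+ 2 <= w by apply: le_trans z_small; rewrite expr2 ler_piMl ?(ltW z0).
have h4 : minority_size L * z ^+ 4 <= minority_size L' * w.
  rewrite (_ : z ^+ 4 = z ^+ 2 * z ^+ 2); last by ring.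
  rewrite mulrA; apply: le_trans (_ : minority_size L * z ^+ 2 * w <= _).
    by rewrite ler_wpM2l // ltW // mulr_gt0 ?minority_size_gt0 // exprn_gt0.
  by rewrite ler_wpM2r ?(ltW w0).
have h5 : minority_size L * expR (- (L / 2)) * w <= minority_size L' * w.
  by rewrite ler_wpM2r ?(ltW w0).
have := ler_wpM2l (ltW (minority_size_gt0 L')) w_small.
have := minority_size_gt0 L'; rewrite /mu /c.
rewrite (_ : 296 * _ * _ = 296 * (minority_size L * expR (- (L / 2)) * w) +
   296 * (minority_size L * z ^+ 4)); last by ring.
lra.
Qed.

Lemma minority_stay B : ~~ consensusb B -> #|B|%:R <= minority_size h -> 0 <= h ->
  m <= N ->
  \sum_v adopt_prob R E B v <= z * #|B|%:R.
Proof.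
move=> ncB Bh h0 mN; apply: le_trans (minority_drift_le h0 ncB Bh) _.
rewrite ler_wpM2r //.
have e2 : expR (- (h / 2)) <= z ^+ 2.
  rewrite -expRM_natl ler_expR /h mulrN lerN2.
  have : ln m <= ln N by rewrite ler_ln ?posrE.
  lra.
have z2 : z ^+ 2 <= z * w by rewrite expr2 ler_wpM2l ?(ltW z0).
have ew : expR (- (h / 2)) * w <= expR (- (h / 2)) * 1.
  by rewrite ler_wpM2l ?expR_ge0 //; have := w_small; lra.
have z4 : z ^+ 4 <= z ^+ 2.
  rewrite (_ : z ^+ 4 = z ^+ 2 * z ^+ 2); last by ring.
  rewrite ler_piMl ?exprn_ge0 ?(ltW z0) //.
  by rewrite exprn_ile1 ?(ltW z0) //; have := z_small; have := w_small; lra.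
have := ler_wpM2l (ltW z0) w_small; have := z0; lra.
Qed.

(** For fewer than [sqrt n] vertices there is no concentration, but their expected
    number contracts. *)
Lemma survival_minority_small k B : ~~ consensusb B ->
  #|B|%:R <= minority_size h -> 0 <= a -> 0 <= h -> m <= N ->
  survival R E k B <= z ^+ k * #|B|%:R + k%:R * N^-1.
Proof.
move=> + + a0 h0 mN; elim: k B => [|k IH] B ncB Bh.
  rewrite survival0 // expr0 mul1r mul0r addr0 ler1n card_gt0.
  by apply: contraNneq ncB => ->; rewrite /consensusb eqxx.
rewrite survivalS //.
have zk0 : 0 <= z ^+ k by rewrite exprn_ge0 // ltW.
have Ni0 : 0 <= N^-1 by rewrite invr_ge0 ltW.
apply: (@le_trans _ _ (\sum_B' random_subset (adopt_prob R E B) B' *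
  ((~~ (#|B'|%:R <= minority_size h))%:R + z ^+ k * #|B'|%:R + k%:R * N^-1))).
  apply: ler_sum => B' _; rewrite ler_wpM2l ?(bo3_step_ge0 R E B B') //.
  have r0 : 0 <= z ^+ k * #|B'|%:R + k%:R * N^-1 by rewrite addr_ge0 ?mulr_ge0.
  have [cB'|ncB'] := boolP (consensusb B').
    by rewrite survival_consensus // -addrA addr_ge0.
  case: (boolP (#|B'|%:R <= minority_size h)) => hB' /=; first by rewrite add0r IH.
  by apply: le_trans (survival_le1 _ _ _ _) _; rewrite -addrA lerDl.
under eq_bigr do rewrite !mulrDr.
rewrite !big_split /= -mulr_suml random_subset_sum1 mul1r.
rewrite -natr1 mulrDl mul1r [_ * N^-1 + N^-1]addrC addrA; apply: lerD => //.
rewrite addrC; apply: lerD.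
  under eq_bigr do rewrite mulrCA.
  rewrite -mulr_sumr sum_card_random_subset exprSr -mulrA ler_wpM2l //.
  exact: minority_stay.
apply: le_trans (_ : _ <= subset_prob (adopt_prob R E B)
    (fun B' => ~~ (#|B'|%:R <= minority_size h))) _.
  rewrite /subset_prob [leRHS]big_mkcond /=; apply: ler_sum => B' _.
  by case: (#|B'|%:R <= minority_size h); rewrite /= ?mulr0 ?mulr1.
apply: le_trans (minority_step h0 ncB Bh); apply: le_subset_prob => [|B'].
  exact: adopt_prob_01.
apply: contraNN => /le_trans; apply; apply: minority_size_anti.
by rewrite /next_exponent !le_min lexx andbT; apply/andP; split; lra.
Qed.

Definition exponent t : R := iter t next_exponent 1.

Lemma exponent_ge1 t : 0 <= a -> 1 <= h -> 1 <= exponent t.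
Proof.
move=> a0 h1; elim: t => [|t IH] //=.
by rewrite /next_exponent !le_min h1 andbT; apply/andP; split; lra.
Qed.

(** Each step multiplies the exponent by [3/2], or adds [a] to it, or brings it to [h];
    if fewer than [j] steps did the first, then at least [k] did the second. *)
Lemma exponent_ge j k : 0 <= a -> 1 <= h ->
  Num.min ((3 / 2) ^+ j) (Num.min (k%:R * a) h) <= exponent (j + k).
Proof.
move=> a0 h1.
have [t] := ubnP (j + k); elim: t j k => // t IH j k; rewrite ltnS.
case: j => [|j] jk.
  by rewrite add0n ge_min expr0 exponent_ge1.
case: k jk => [|k] jk.
  by rewrite ge_min mul0r ge_min (le_trans ler01) ?exponent_ge1 // ?orbT.
have e1 := exponent_ge1 (j + k.+1) a0 h1.
have I1 : Num.min ((3 / 2) ^+ j) (Num.min (k.+1%:R * a) h) <= exponent (j + k.+1) by apply: IH.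
have I2 : Num.min ((3 / 2) ^+ j.+1) (Num.min (k%:R * a) h) <= exponent (j + k.+1).
  by rewrite -addSnnS; apply: IH; rewrite -addSnnS in jk.
have k0 : 0 <= k.+1%:R * a by rewrite mulr_ge0.
have p0 : 0 < (3 / 2 : R) ^+ j by rewrite exprn_gt0 // divr_gt0.
rewrite addSn /exponent iterS -/(exponent _) /next_exponent !le_min.
move: I1 I2; rewrite exprS -[k.+1%:R]natr1 mulrDl mul1r !ge_min.
rewrite -[k.+1%:R]natr1 mulrDl mul1r in k0.
move=> /or3P I1 /or3P I2; apply/and3P; split.
- by case: I1 => I1; apply/or3P; [apply: Or31|apply: Or32|apply: Or33]; lra.
- by case: I2 => I2; apply/or3P; [apply: Or31|apply: Or32|apply: Or33]; lra.
- by rewrite lexx !orbT.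
Qed.

Lemma survival_minority t k B : 0 <= a -> 1 <= h -> m <= N ->
  h <= exponent t -> #|B|%:R <= minority_size 1 ->
  survival R E (t + k) B <= t%:R * N^-1 + (z ^+ k * minority_size h + k%:R * N^-1).
Proof.
move=> a0 h1 mN th B1.
have Ni0 : 0 <= N^-1 by rewrite invr_ge0 ltW.
have zk0 : 0 <= z ^+ k by rewrite exprn_ge0 // ltW.
apply: (survival_chain_le (G := fun i B => #|B|%:R <= minority_size (exponent i))) => //.
- by rewrite addr_ge0 // mulr_ge0 // ltW // minority_size_gt0.
- move=> i B' it ncB' hB'; apply: minority_step => //.
  by apply: le_trans (exponent_ge1 i a0 h1).
- move=> B' ncB' hB'.
  have hB : #|B'|%:R <= minority_size h by apply: le_trans hB' (minority_size_anti th).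
  apply: le_trans (survival_minority_small k ncB' hB a0 _ mN) _; first lra.
  by rewrite lerD2r ler_wpM2l.
Qed.

End Minority.

(** * Asymptotic estimates *)

Section Asymptotics.
Variable R : realType.

Lemma near_ln_ge (K : R) : \forall n \near \oo, K <= ln n%:R.
Proof.
near=> n; rewrite -[K]expRK ler_ln ?posrE ?expR_gt0 //.
  by near: n; exact: nbhs_infty_ger.
by near: n; exact: nbhs_infty_gtr.
Unshelve. all: by end_near. Qed.

(** The right-hand side is the square root of [n]. *)
Lemma near_ln_le_sqrt (K : R) : \forall n \near \oo, K * ln n%:R <= expR (ln n%:R / 2).
Proof.
near=> n.
have l0 : 0 <= ln (n%:R : R) by near: n; exact: near_ln_ge.
have lK : 16 * K <= ln (n%:R : R) by near: n; exact: near_ln_ge.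
set l := ln _ in l0 lK *.
have -> : expR (l / 2) = expR (l / 4) ^+ 2.
  by rewrite -expRM_natl; congr expR; field.
have h : l / 4 <= expR (l / 4) by apply: le_trans (expR_ge1Dx _); rewrite lerDr.
have l40 : 0 <= l / 4 by rewrite divr_ge0.
apply: (@le_trans _ _ ((l / 4) ^+ 2)); last by rewrite ler_pXn2r ?nnegrE ?expR_ge0.
have : (16 * K) * l <= l * l by rewrite ler_wpM2r.
by rewrite expr2; lra.
Unshelve. all: by end_near. Qed.

Variable p : nat -> R.
Hypothesis p_large : p n / (ln n%:R / n%:R) @[n --> \oo] --> +oo.

Lemma near_degree_ge_ln (K : R) : \forall n \near \oo, K * ln n%:R <= n%:R * p n.
Proof.
near=> n.
have l1 : 1 <= ln (n%:R : R) by near: n; exact: near_ln_ge.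
have n0 : 0 < n%:R :> R by near: n; exact: nbhs_infty_gtr.
have : K <= p n / (ln n%:R / n%:R).
  by near: n; move/cvgryPge : p_large; exact.
rewrite ler_pdivlMr ?divr_gt0 //; last by apply: lt_le_trans l1.
by rewrite mulrA ler_pdivrMr // [p n * _]mulrC.
Unshelve. all: by end_near. Qed.

Lemma near_degree_ge (K : R) : \forall n \near \oo, K <= n%:R * p n.
Proof.
near=> n.
have l1 : 1 <= ln (n%:R : R) by near: n; exact: near_ln_ge.
have l0 : `|K| * ln n%:R <= n%:R * p n by near: n; exact: near_degree_ge_ln.
apply: le_trans l0; apply: le_trans (ler_norm K) _.
by rewrite ler_peMr.
Unshelve. all: by end_near. Qed.

End Asymptotics.

Lemma powR_expR (R : realType) (x c : R) : 0 < x -> x `^ c = expR (c * ln x).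
Proof. by move=> x0; rewrite /powR gt_eqF. Qed.

Lemma expRN_le_inv (R : realType) (x : R) : 0 < x -> expR (- x) <= x^-1.
Proof.
move=> x0; rewrite expRN lef_pV2 ?posrE ?expR_gt0 //.
by apply: le_trans (expR_ge1Dx _); rewrite lerDr.
Qed.

Lemma truncn_bounds (R : realType) (x : R) : 0 <= x ->
  x <= (Num.truncn x).+1%:R /\ (Num.truncn x).+1%:R <= x + 1.
Proof.
move=> x0; have /andP[lo hi] := truncn_itv x0.
by split; [exact: ltW|rewrite -natr1 lerD2r].
Qed.

Lemma three_halves_pow_ge (R : realType) (j : nat) (y : R) : 0 < y ->
  3 * ln y <= j%:R -> y <= (3 / 2) ^+ j.
Proof.
move=> y0 yj; have e : expR (1 / 3) <= 3 / 2 :> R.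
  by apply: le_trans (expR_le_inv _) _; [lra|rewrite invf_ple ?posrE; lra].
apply: (@le_trans _ _ (expR (1 / 3) ^+ j)); last first.
  by apply: lerXn2r; rewrite ?nnegrE ?expR_ge0 // divr_ge0.
rewrite -expRM_natl -{1}(lnK y0) ler_expR; lra.
Qed.

(** * The two regimes on a fixed graph *)

Section FixedGraph.
Variables (R : realType) (n : nat) (p r eps w : R) (E : {set {set vertex n}}).
Implicit Types (A B : {set vertex n}).
Local Notation N := (n%:R : R).
Local Notation m := (N * p).

Lemma card_setC_vertex A : #|(~: A)%SET|%:R = 2 * N - #|A|%:R :> R.
Proof.
have := cardsC A; rewrite card_vertex => /(congr1 (fun k => k%:R : R)).
by rewrite natrD natrM; lra.
Qed.

Hypotheses (n0 : (0 < n)%N) (p01 : 0 < p <= 1) (r01 : 0 <= r <= 1).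

Let N0 : 0 < N. Proof. by rewrite ltr0n. Qed.
Let m0 : 0 < m. Proof. by case/andP: p01 => p0 _; rewrite mulr_gt0. Qed.

Lemma imbalanced_coords kappa A : imbalanced kappa A ->
  kappa / 2 <= `|(coords R A).1|.
Proof.
rewrite /imbalanced card_setC_vertex coords1E // => h.
rewrite -(ler_pM2r N0) -{3}(gtr0_norm N0) -normrM mulrBl divfK ?gt_eqF // mul1r.
move: h; rewrite (_ : #|A|%:R - _ = 2 * (#|A|%:R - N)); last by ring.
by rewrite normrM ger0_norm //; lra.
Qed.

Lemma survival_imbalanced M t k kappa A :
  0 < eps <= 1 -> low_discrepancy p (r * p) eps E ->
  regular_degrees p E -> sparse p E ->
  0 < w -> w <= 1 / 2048 -> decay n p <= w ->
  6 * ln N <= minority_size n w (ln N / 2) ->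
  1 <= ln m -> 1 <= ln N / 2 ->
  ln N / 2 <= exponent n p t ->
  14 * eps * 4 ^+ M <= w ^+ 2 * expR (- 1) / 2 ->
  (forall x, in_diamond x -> kappa / 2 <= `|x.1| ->
     1 - w ^+ 2 * expR (- 1) / 2 <= `|(iter M (flow (drift_ratio r)) x).1|) ->
  imbalanced kappa A ->
  survival R E (M + (t + k)) A <=
    M%:R * (4 * expR (- (eps ^+ 2 * N / 8))) +
    (t%:R * N^-1 + (decay n p ^+ k * minority_size n w (ln N / 2) + k%:R * N^-1)).
Proof.
move=> e01 discE regE spE w0 w1 zw logn lm lN th epsM orbit Aimb.
have /andP[p0 p1] := p01.
have mN : m <= N by rewrite ler_piMr // ltW.
have a0 : 0 <= ln m / 4 by lra.
have deg0 v : (0 < #|nbrs E v|)%N by exact: regular_nbrs_gt0 regE v.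
have minor B : #|B|%:R <= minority_size n w 1 -> survival R E (t + k) B <=
    t%:R * N^-1 + (decay n p ^+ k * minority_size n w (ln N / 2) + k%:R * N^-1).
  by move=> h; apply: survival_minority.
apply: (survival_pseudo_orbit n0 r01 p0 e01 discE _ orbit _ (imbalanced_coords Aimb)).
  have i0 : 0 <= N^-1 by rewrite invr_ge0 ltW.
  have s0 := ltW (minority_size_gt0 n0 w0 (ln N / 2)).
  have z0 : 0 <= decay n p ^+ k by rewrite exprn_ge0 // expR_ge0.
  by apply: addr_ge0; [|apply: addr_ge0]; exact: mulr_ge0.
move=> B Bs.
have : 1 - w ^+ 2 * expR (- 1) <= `|(coords R B).1| by lra.
rewrite coords1E // ler_normr => /orP[] h.
  rewrite -survivalC //; apply: minor; rewrite card_setC_vertex.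
  have : (2 - w ^+ 2 * expR (- 1)) * N <= #|B|%:R by rewrite -ler_pdivlMr //; lra.
  by rewrite /minority_size; lra.
apply: minor; have : #|B|%:R <= (w ^+ 2 * expR (- 1)) * N.
  by rewrite -ler_pdivrMr //; lra.
by rewrite /minority_size; lra.
Qed.

End FixedGraph.

Section Trapped.
Variables (R : realType) (n : nat) (p r eps : R) (E : {set {set vertex n}}).
Implicit Types (A B : {set vertex n}).
Hypotheses (n0 : (0 < n)%N) (p0 : 0 < p) (r0 : 0 <= r) (e01 : 0 < eps <= 1).
Hypothesis (discE : low_discrepancy p (r * p) eps E).

Definition in_trap (s0 d0 : R) A : bool :=
  (`|(coords R A).1| <= s0) && (d0 <= (coords R A).2).

Lemma survival_trapped s0 d0 k A : 0 < d0 ->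
  (forall s d, `|s| <= s0 -> d0 <= d <= 1 ->
     `|(flow (drift_ratio r) (s, d)).1| <= s0 - 14 * eps /\
     d0 + 14 * eps <= (flow (drift_ratio r) (s, d)).2) ->
  in_trap s0 d0 A ->
  1 - k%:R * (4 * expR (- (eps ^+ 2 * n%:R / 8))) <= survival R E k A.
Proof.
move=> d00 trap; apply: survival_invariant_ge.
- by rewrite mulr_ge0 ?expR_ge0.
- move=> B /andP[_ dB]; apply/negP => cB.
  have : (coords R B).2 = 0.
    rewrite /= /density; case/orP: cB => /eqP ->.
      by rewrite !finset.set0I !cards0 mul0r subrr.
    by rewrite !finset.setTI !card_block subrr.
  by move=> d0B; rewrite d0B in dB; lra.
- move=> B /andP[sB dB].
  apply: le_trans (coords_step n0 r0 p0 discE B e01).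
  apply: le_subset_prob => [|B']; first exact: adopt_prob_01.
  apply: contraNN => /andP[]; rewrite -/(drift_ratio r).
  have dB1 : d0 <= (coords R B).2 <= 1.
    rewrite dB /=; have /andP[? ?] := density_01 R n0 B true.
    by have /andP[? ?] := density_01 R n0 B false; lra.
  have [] := trap _ _ sB dB1; rewrite -surjective_pairing.
  move: (flow _ _) => y h1 h2 h3 h4.
  have := ler_normD y.1 ((coords R B').1 - y.1); rewrite addrC subrK => h5.
  by move: h4; rewrite ler_norml => /andP[h4 _]; apply/andP; split; lra.
Qed.

(** For [k] of order [n] but small, its coordinates [(k / n, 1 - k / n)] lie in the trap. *)
Definition first_block_and (k : nat) : {set vertex n} :=
  [set v : vertex n | v.1 || ((v.2 : 'I_n) < k)%N]%SET.

Lemma density_first_block_and k : (k <= n)%N ->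
  density R (first_block_and k) true = 1 /\
  density R (first_block_and k) false = k%:R / n%:R.
Proof.
move=> kn; have N0 : n%:R != 0 :> R by rewrite pnatr_eq0 -lt0n.
split; rewrite /density.
  rewrite (_ : _ :&: _ = block n true)%SET ?card_block ?divff //.
  by apply/setP => v; rewrite !inE; case: (v.1); rewrite ?andbF.
congr (_%:R / _).
rewrite -[RHS](card_ord k) -(card_imset _ (_ : injective (fun i : 'I_k => (false, widen_ord kn i) : vertex n))).
  apply: eq_card => -[b i]; rewrite !inE /=; apply/andP/imsetP => [[h /eqP b0]|[j _ [-> ->]]].
    by rewrite b0 /= in h *; exists (Ordinal h) => //; congr pair; exact: val_inj.
  by rewrite /= ltn_ord.
by move=> i j [] /val_inj.
Qed.

End Trapped.

(** * The phase transition *)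

Lemma sbm_prob_typical (R : realType) (n : nat) (p q eps : R)
    (Q : {set {set vertex n}} -> Prop) :
  (4 <= n)%N -> 0 <= q -> q <= p -> p <= 1 ->
  0 < eps <= 1 -> 4 <= eps * n%:R -> 1280 <= eps ^+ 2 * (n%:R * p) ->
  256 <= n%:R * p -> 1024 * ln n%:R <= n%:R * p ->
  9 <= expR (ln n%:R / 2 : R) ->
  (forall E, low_discrepancy p q eps E -> regular_degrees p E -> sparse p E -> Q E) ->
  1 - expR (- (ln n%:R / 2)) <= sbm_prob p q Q.
Proof.
move=> n4 q0 qp p1 e01 en epn m256 mln l9 HQ.
have n0 : (0 < n)%N by exact: leq_trans n4.
have N0 : 0 < n%:R :> R by rewrite ltr0n.
have w01 := sbm_weight_01 (n := n) q0 qp p1.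
pose bad := fun E : {set {set vertex n}} =>
  ~~ low_discrepancy p q eps E || (~~ regular_degrees p E || ~~ sparse p E).
apply: le_trans (sbm_prob_ge q0 qp p1 (bad := bad) _); last first.
  by move=> E _; rewrite /bad !negb_or !negbK => /and3P[]; exact: HQ.
rewrite lerD2l lerN2.
have b1 := prob_not_low_discrepancy q0 qp p1 e01 en epn.
have b2 := prob_not_regular_degrees q0 qp p1 n4.
have b3 := prob_not_sparse q0 qp p1 n0 m256.
have b12 := subset_probU (fun E => ~~ low_discrepancy p q eps E)
  (fun E => ~~ regular_degrees p E || ~~ sparse p E) w01.
have b23 := subset_probU (fun E : {set {set vertex n}} => ~~ regular_degrees p E) (fun E => ~~ sparse p E) w01.
apply: le_trans b12 _; apply: le_trans (lerD b1 (le_trans b23 (lerD b2 b3))) _.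
set l := ln _ in mln l9 *.
have lE : n%:R^-1 = expR (- (l / 2)) * expR (- (l / 2)) :> R.
  by rewrite -expRD -(expR_lnN N0); congr expR; rewrite -/l; field.
have h1 : expR (- n%:R) <= n%:R^-1 :> R by exact: expRN_le_inv.
have h2 : n%:R * expR (- (n%:R * p / 512)) <= n%:R^-1.
  rewrite -{1}(lnK N0) -(expR_lnN N0) -/l -expRD ler_expR; lra.
have h3 : 9 * n%:R^-1 <= expR (- (l / 2)).
  rewrite lE mulrA ler_piMl ?expR_ge0 // expRN ler_pdivrMr ?expR_gt0 //.
  by rewrite mul1r.
lra.
Qed.

(** With [l = ln n] and [a = ln m]: the number [j] of steps at which the exponent grows
    by the factor [3/2], the number [k1] of steps at which it grows by [a / 4], and the
    number [k2] of steps that extinguish a minority of at most [sqrt n] vertices. *)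
Lemma exists_step_counts (R : realType) (l a : R) : 2 <= l -> 1 <= a -> a <= l ->
  exists j k1 k2 : nat,
    [/\ l / 2 <= (3 / 2) ^+ j, l / 2 <= k1%:R * (a / 4), l <= k2%:R * (a / 8) &
        (j + k1 + k2)%:R <= 3 * ln l + 10 * (l / a) + 3].
Proof.
move=> l2 a1 al; have a0 : 0 < a by lra.
have l0 : 0 < l by lra.
have ll0 : 0 <= ln l by rewrite ln_ge0; lra.
have lq0 : 0 <= l / a by rewrite divr_ge0 ?(ltW l0) ?(ltW a0).
have lE : l / a * a = l by rewrite divfK // gt_eqF.
exists (Num.truncn (3 * ln l)).+1, (Num.truncn (2 * (l / a))).+1,
  (Num.truncn (8 * (l / a))).+1.
have [|j1 j2] := @truncn_bounds R (3 * ln l); first by rewrite mulr_ge0.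
have [|b1 b2] := @truncn_bounds R (2 * (l / a)); first by rewrite mulr_ge0.
have [|c1 c2] := @truncn_bounds R (8 * (l / a)); first by rewrite mulr_ge0.
split.
- apply: (@le_trans _ _ l); first lra.
  exact: three_halves_pow_ge.
- have := ler_wpM2r (ltW a0) b1; rewrite -mulrA lE; lra.
- have := ler_wpM2r (ltW a0) c1; rewrite -mulrA lE; lra.
- by rewrite !natrD; lra.
Qed.

Lemma failure_le (R : realType) (n M t k : nat) (p eps w : R) :
  (0 < n)%N -> 0 < eps -> 0 < w -> w <= 1 -> 1 <= ln (n%:R : R) ->
  32 * M%:R / eps ^+ 2 * ln n%:R <= expR (ln n%:R / 2) ->
  (t + k)%:R <= expR (ln n%:R / 2 : R) ->
  ln n%:R <= k%:R * (ln (n%:R * p) / 8) ->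
  M%:R * (4 * expR (- (eps ^+ 2 * n%:R / 8))) +
    (t%:R * n%:R^-1 + (decay n p ^+ k * minority_size n w (ln n%:R / 2) + k%:R * n%:R^-1))
  <= 3 * expR (- (ln n%:R / 2)).
Proof.
move=> n0 e0 w0 w1; have N0 : 0 < n%:R :> R by rewrite ltr0n.
have e20 : 0 < eps ^+ 2 by rewrite exprn_gt0.
set l := ln _; set v := expR (- (l / 2)); set x := expR (l / 2) => l1 sM tk lk.
have nE : n%:R = x * x.
  by rewrite -expRD -[LHS](lnK N0) -/l; congr expR; field.
have x0 : 0 < x by exact: expR_gt0.
have vE : v = x^-1 by rewrite /v expRN.
have small y : y <= x -> y / n%:R <= v.
  by move=> yx; rewrite ler_pdivrMr // nE vE mulrA mulVf ?mul1r ?gt_eqF.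
have t1 : M%:R * (4 * expR (- (eps ^+ 2 * n%:R / 8))) <= v.
  have h : expR (- (eps ^+ 2 * n%:R / 8)) <= (eps ^+ 2 * n%:R / 8)^-1.
    by apply: expRN_le_inv; rewrite divr_gt0 // mulr_gt0.
  apply: le_trans (_ : M%:R * (4 * (eps ^+ 2 * n%:R / 8)^-1) <= _).
    by rewrite ler_wpM2l // ler_wpM2l.
  have c0 : 0 <= 32 * M%:R / eps ^+ 2 by apply: divr_ge0; [exact: mulr_ge0|exact: ltW].
  have c1 : 32 * M%:R / eps ^+ 2 <= x by apply: le_trans sM; rewrite ler_peMr.
  rewrite (_ : M%:R * _ = 32 * M%:R / eps ^+ 2 / n%:R); last by field; rewrite !gt_eqF.
  exact: small.
have t2 : (t + k)%:R * n%:R^-1 <= v by exact: small.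
have t3 : decay n p ^+ k * minority_size n w (l / 2) <= v.
  have d1 : decay n p ^+ k <= v * v.
    rewrite /decay -expRM_natl -expRD ler_expR; move: lk.
    by rewrite mulrN -opprD lerN2 => /(le_trans _); apply; lra.
  have s1 : minority_size n w (l / 2) <= x.
    rewrite /minority_size -/v nE vE (_ : _ * _ / x = x * w ^+ 2); last by field; rewrite gt_eqF.
    by rewrite ler_piMr ?exprn_ile1 ?(ltW w0) ?(ltW x0).
  apply: le_trans (_ : v * v * x <= _).
    apply: ler_pM => //; first by rewrite exprn_ge0 ?expR_ge0.
    exact: ltW (minority_size_gt0 n0 w0 _).
  by rewrite vE -mulrA mulVf ?mulr1 ?gt_eqF.
rewrite natrD mulrDl in t2; lra.
Qed.

Lemma near_p_gt0 (R : realType) (p q : nat -> R)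
  (hpq : forall n : nat, 0 <= q n /\ q n <= p n /\ p n <= 1)
  (hp : p n / (ln n%:R / n%:R) @[n --> \oo] --> +oo) :
  \forall n \near \oo, 0 < p n.
Proof.
near=> n.
have m1 : 1 <= n%:R * p n by near: n; exact: near_degree_ge.
have [q0 [qp _]] := hpq n.
rewrite lt0r (le_trans q0 qp) andbT; apply: contraTneq m1 => ->.
by rewrite mulr0 -ltNge ltr01.
Unshelve. all: by end_near. Qed.

Lemma near_qE (R : realType) (p q : nat -> R) (r : R)
  (hpq : forall n : nat, 0 <= q n /\ q n <= p n /\ p n <= 1)
  (hp : p n / (ln n%:R / n%:R) @[n --> \oo] --> +oo)
  (hr : \forall n \near \oo, q n / p n = r) :
  \forall n \near \oo, q n = r * p n.
Proof.
near=> n.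
have p0 : 0 < p n by near: n; exact: near_p_gt0 hpq hp.
have <- : q n / p n = r by near: n; exact: hr.
by rewrite divfK // gt_eqF.
Unshelve. all: by end_near. Qed.

Lemma ratio_01 (R : realType) (p q : nat -> R) (r : R)
  (hpq : forall n : nat, 0 <= q n /\ q n <= p n /\ p n <= 1)
  (hp : p n / (ln n%:R / n%:R) @[n --> \oo] --> +oo)
  (hr : \forall n \near \oo, q n / p n = r) :
  0 <= r <= 1.
Proof.
have [n _ /(_ n (leqnn n)) [p0 qE]] : \forall n \near \oo, 0 < p n /\ q n / p n = r.
  by near=> n; split; near: n; [exact: near_p_gt0 hpq hp|exact: hr].
have [q0 [qp _]] := hpq n.
rewrite -qE; apply/andP; split; first by rewrite divr_ge0 // ltW.
by rewrite ler_pdivrMr // mul1r.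
Unshelve. all: by end_near. Qed.

Lemma fast_consensus (R : realType) (p q : nat -> R) (r kappa : R)
  (hpq : forall n : nat, 0 <= q n /\ q n <= p n /\ p n <= 1)
  (hp : p n / (ln n%:R / n%:R) @[n --> \oo] --> +oo)
  (hr : \forall n \near \oo, q n / p n = r) :
  1 / 7 < r -> 0 < kappa ->
    exists C C' K : R, [/\ 0 < C, 0 < C', 0 < K &
      whp p q (fun (n : nat) (E : {set {set vertex n}}) =>
        forall A : {set vertex n}, imbalanced kappa A ->
          Tcons_prob_ge E A
            (fun T : \bar R =>
               (T <= (C * (ln (ln n%:R) + ln n%:R / ln (n%:R * p n)))%:E)%E)
            (1 - K * n%:R `^ (- C')))].
Proof.
move=> r7 k0; have r01 := ratio_01 hpq hp hr; have /andP[r0 r1] := r01.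
have [w w0 w1] : exists2 w : R, 0 < w & w <= 1 / 2048 by exists (1 / 2048); lra.
pose c3 := w ^+ 2 * expR (- 1).
have c30 : 0 < c3 by rewrite mulr_gt0 ?expR_gt0 // exprn_gt0.
have u34 : drift_ratio r < 3 / 4 by rewrite /drift_ratio ltr_pdivrMr; lra.
have k20 : 0 < kappa / 2 by rewrite divr_gt0.
have c320 : 0 < c3 / 2 by rewrite divr_gt0.
have [M orbit] := iter_flow_consensus (drift_ratio_01 r01) u34 k20 c320.
have M0 : 0 < 4 ^+ M :> R by rewrite exprn_gt0.
pose eps := Num.min 1 (c3 / 28 / 4 ^+ M).
have e0 : 0 < eps by rewrite lt_min ltr01 divr_gt0 // divr_gt0.
have e1 : eps <= 1 by rewrite ge_min lexx.
have eM : 14 * eps * 4 ^+ M <= c3 / 2.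
  have : eps * 4 ^+ M <= c3 / 28 by rewrite -ler_pdivlMr // ge_min lexx orbT.
  lra.
have e20 : 0 < eps ^+ 2 by rewrite exprn_gt0.
exists (M%:R + 13), (1 / 2), 3; split; [by have := ler0n R M; lra|lra|lra|].
exists (1 / 2); first by rewrite divr_gt0.
near=> n.
have n4 : (4 <= n)%N by near: n; exact: nbhs_infty_ge.
have n0 : (0 < n)%N by exact: leq_trans n4.
have N0 : 0 < n%:R :> R by rewrite ltr0n.
have p0 : 0 < p n by near: n; exact: near_p_gt0 hpq hp.
have qE : q n = r * p n by near: n; exact: near_qE hpq hp hr.
have [q0 [qp p1]] := hpq n; rewrite qE in q0 qp.
have p01 : 0 < p n <= 1 by rewrite p0.
have l2 : 2 <= ln (n%:R : R) by near: n; exact: near_ln_ge.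
have s9 : 9 * ln n%:R <= expR (ln n%:R / 2 : R) by near: n; exact: near_ln_le_sqrt.
have ne : 4 / eps <= n%:R by near: n; exact: nbhs_infty_ger.
have me : 1280 / eps ^+ 2 <= n%:R * p n by near: n; exact: near_degree_ge.
have m256 : 256 <= n%:R * p n by near: n; exact: near_degree_ge.
have mln : 1024 * ln n%:R <= n%:R * p n by near: n; exact: near_degree_ge_ln.
have m3 : expR 1 <= n%:R * p n by near: n; exact: near_degree_ge.
have mw : expR (- ln w * 8) <= n%:R * p n by near: n; exact: near_degree_ge.
have s6 : 6 / w ^+ 2 * ln n%:R <= expR (ln n%:R / 2) by near: n; exact: near_ln_le_sqrt.
have sM : 32 * M%:R / eps ^+ 2 * ln n%:R <= expR (ln n%:R / 2).
  by near: n; exact: near_ln_le_sqrt.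
have s30 : 30 * ln n%:R <= expR (ln n%:R / 2 : R) by near: n; exact: near_ln_le_sqrt.
have powE : n%:R `^ (- (1 / 2)) = expR (- (ln n%:R / 2)) :> R.
  by rewrite powR_expR //; congr expR; field.
rewrite !powE; set l := ln n%:R; set m := n%:R * p n; set v := expR (- (l / 2)).
rewrite -/l in l2 s9 mln s6 sM s30; rewrite -/m in me m256 mln m3 mw.
have m_pos : 0 < m by rewrite mulr_gt0.
have lm1 : 1 <= ln m.
  by rewrite -[leLHS]expRK ler_ln ?posrE ?expR_gt0.
have lml : ln m <= l by rewrite ler_ln ?posrE // ler_piMr // ltW.
have lm0 : 0 < ln m by exact: lt_le_trans lm1.
rewrite qE; apply: (@sbm_prob_typical R n (p n) (r * p n) eps) => //.
- by rewrite e0.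
- by rewrite mulrC -ler_pdivrMr.
- by rewrite mulrC -ler_pdivrMr.
- by rewrite -/l; clear - l2 s9; lra.
move=> E discE regE spE A Aimb.
have [j [k1 [k2 [hj hk1 hk2 hT]]]] := exists_step_counts l2 lm1 lml.
have lq1 : 1 <= l / ln m by rewrite ler_pdivlMr // mul1r.
have nE : n%:R = expR (l / 2) * expR (l / 2).
  by rewrite -expRD -[LHS](lnK N0) -/l; congr expR; field.
have sizeE : minority_size n w (l / 2) = w ^+ 2 * expR (l / 2).
  rewrite /minority_size nE expRN; field.
  by rewrite gt_eqF ?expR_gt0.
have ll0 : 0 <= ln l by rewrite ln_ge0 //; apply: le_trans l2; rewrite ler1n.
apply: (@Tcons_prob_le R _ E A (M + (j + k1 + k2))).
  clear - hT lq1 ll0; rewrite natrD.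
  have : M%:R * 1 <= M%:R * (l / ln m) by rewrite ler_wpM2l.
  have : 0 <= M%:R * ln l by rewrite mulr_ge0.
  lra.
rewrite lerD2l lerN2.
have size6 : 6 * l <= minority_size n w (l / 2).
  by rewrite sizeE [w ^+ 2 * _]mulrC -ler_pdivrMr ?exprn_gt0 // mulrAC.
have zw : decay n (p n) <= w.
  rewrite /decay -[leRHS](lnK w0) ler_expR lerNl ler_pdivlMr //.
  by rewrite -[leLHS]expRK ler_ln ?posrE ?expR_gt0.
have h1 : 1 <= l / 2 by clear - l2; lra.
have a0 : 0 <= ln m / 4 by clear - lm1; lra.
have th : l / 2 <= exponent n (p n) (j + k1).
  by apply: le_trans (exponent_ge j k1 a0 h1); rewrite !le_min lexx hj hk1.
have e01 : 0 < eps <= 1 by rewrite e0.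
apply: le_trans (survival_imbalanced n0 p01 r01 k2 e01 discE regE spE w0 w1 zw size6 lm1 h1 th eM orbit Aimb) _.
apply: failure_le => //.
- by clear - w1; lra.
- by apply: le_trans l2; rewrite ler1n.
- apply: le_trans hT _; apply: le_trans s30.
  have h2 : ln l <= l by apply: ltW; apply: ln_sublinear; clear - l2; lra.
  have h3 : l / ln m <= l by rewrite ler_pdivrMr // ler_peMr //; clear - l2; lra.
  by clear - l2 h2 h3; lra.
Unshelve. all: by end_near. Qed.

Lemma slow_consensus (R : realType) (p q : nat -> R) (r : R)
  (hpq : forall n : nat, 0 <= q n /\ q n <= p n /\ p n <= 1)
  (hp : p n / (ln n%:R / n%:R) @[n --> \oo] --> +oo)
  (hr : \forall n \near \oo, q n / p n = r) :
  r < 1 / 7 ->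
    exists kappa C C' K : R, [/\ 0 < kappa, 0 < C, 0 < C', 0 < K &
      whp p q (fun (n : nat) (E : {set {set vertex n}}) =>
        exists2 A : {set vertex n}, imbalanced kappa A &
          Tcons_prob_ge E A
            (fun T : \bar R => ((expR (C * n%:R))%:E <= T)%E)
            (1 - K * n%:R `^ (- C')))].
Proof.
move=> r7; have r01 := ratio_01 hpq hp hr; have /andP[r0 r1] := r01.
have u34 : 3 / 4 < drift_ratio r by rewrite /drift_ratio ltr_pdivlMr; lra.
have [s0 [d0 [e [s00 d00 sd e0 trap]]]] := flow_trap (drift_ratio_01 r01) u34.
pose eps := Num.min 1 (e / 14).
have ep0 : 0 < eps by rewrite lt_min ltr01 divr_gt0.
have ep1 : eps <= 1 by rewrite ge_min lexx.
have ee : eps <= e / 14 by rewrite ge_min lexx orbT.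
have e20 : 0 < eps ^+ 2 by rewrite exprn_gt0.
pose C := eps ^+ 2 / 16.
have C0 : 0 < C by rewrite divr_gt0.
exists s0, C, 1, (4 / C); split => //; first by rewrite divr_gt0.
exists (1 / 2); first by rewrite divr_gt0.
near=> n.
have n4 : (4 <= n)%N by near: n; exact: nbhs_infty_ge.
have n0 : (0 < n)%N by exact: leq_trans n4.
have N0 : 0 < n%:R :> R by rewrite ltr0n.
have p0 : 0 < p n by near: n; exact: near_p_gt0 hpq hp.
have qE : q n = r * p n by near: n; exact: near_qE hpq hp hr.
have [q0 [qp p1]] := hpq n; rewrite qE in q0 qp.
have l2 : 2 <= ln (n%:R : R) by near: n; exact: near_ln_ge.
have s9 : 9 * ln n%:R <= expR (ln n%:R / 2 : R) by near: n; exact: near_ln_le_sqrt.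
have ne : 4 / eps <= n%:R by near: n; exact: nbhs_infty_ger.
have me : 1280 / eps ^+ 2 <= n%:R * p n by near: n; exact: near_degree_ge.
have m256 : 256 <= n%:R * p n by near: n; exact: near_degree_ge.
have mln : 1024 * ln n%:R <= n%:R * p n by near: n; exact: near_degree_ge_ln.
have sn2' : 2 / s0 <= n%:R by near: n; exact: nbhs_infty_ger.
have powE : n%:R `^ (- (1 / 2)) = expR (- (ln n%:R / 2)) :> R.
  by rewrite powR_expR //; congr expR; field.
have pow1 : n%:R `^ (- 1) = n%:R^-1 :> R by rewrite powR_expR // mulN1r expR_lnN.
rewrite powE pow1; set l := ln n%:R.
rewrite -/l in l2 s9.
rewrite qE; apply: (@sbm_prob_typical R n (p n) (r * p n) eps) => //.
- by rewrite ep0.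
- by rewrite mulrC -ler_pdivrMr.
- by rewrite mulrC -ler_pdivrMr.
- by rewrite -/l; clear - l2 s9; lra.
move=> E discE _ _.
pose k := Num.truncn (s0 * n%:R).
have sn0 : 0 <= s0 * n%:R by rewrite mulr_ge0 // ltW.
have /andP[k1 k2] := truncn_itv sn0; rewrite -/k in k1 k2.
have sn2 : 2 <= s0 * n%:R by rewrite mulrC -ler_pdivrMr.
have kn : (k <= n)%N.
  rewrite -(ler_nat R); apply: le_trans k1 _; rewrite ler_piMl //; clear - sd d00; lra.
have [dt df] := density_first_block_and R n0 kn.
have kN : k%:R / n%:R <= s0 by rewrite ler_pdivrMr.
have kN0 : 0 <= k%:R / n%:R :> R by rewrite divr_ge0.
exists (first_block_and n k).
  have cs : (coords R (first_block_and n k)).1 = #|first_block_and n k|%:R / n%:R - 1.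
    by rewrite coords1E.
  rewrite /imbalanced card_setC_vertex.
  have : #|first_block_and n k|%:R = n%:R + k%:R :> R.
    move: cs; rewrite /coords /= dt df => cs.
    have : #|first_block_and n k|%:R / n%:R = 1 + k%:R / n%:R :> R by clear - cs; lra.
    move/(congr1 (fun x => x * n%:R)); rewrite divfK ?gt_eqF // => ->.
    by rewrite mulrDl mul1r divfK // gt_eqF.
  move=> ->; rewrite (_ : _ - _ = 2 * k%:R); last by ring.
  rewrite ger0_norm ?mulr_ge0 //.
  by rewrite -natr1 in k2; clear - k2 sn2; lra.
pose k' := Num.truncn (expR (C * n%:R)).
have /andP[k1' k2'] := truncn_itv (expR_ge0 (C * n%:R)); rewrite -/k' in k1' k2'.
apply: (@Tcons_prob_ge_survival R _ E _ k'); first exact: ltW.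
have trapA : in_trap s0 d0 (first_block_and n k).
  rewrite /in_trap /coords /= dt df addrC addKr ger0_norm // kN /=.
  by clear - kN sd; lra.
have trap14 s d : `|s| <= s0 -> d0 <= d <= 1 ->
     `|(flow (drift_ratio r) (s, d)).1| <= s0 - 14 * eps /\
     d0 + 14 * eps <= (flow (drift_ratio r) (s, d)).2.
  by move=> ss dd; have [h1 h2] := trap s d ss dd; clear - h1 h2 ee; split; lra.
have e01 : 0 < eps <= 1 by rewrite ep0.
apply: le_trans (survival_trapped n0 p0 r0 e01 discE k' d00 trap14 trapA).
rewrite lerD2l lerN2.
apply: le_trans (_ : expR (C * n%:R) * (4 * expR (- (eps ^+ 2 * n%:R / 8))) <= _).
  by rewrite ler_wpM2r // mulr_ge0 ?expR_ge0.
rewrite mulrCA -expRD (_ : C * n%:R - _ = - (C * n%:R)); last by rewrite /C; field.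
have frac (a b : R) : 4 / a / b = 4 * (a * b)^-1 by rewrite invfM mulrA.
rewrite frac ler_wpM2l //.
by apply: expRN_le_inv; rewrite mulr_gt0.
Unshelve. all: by end_near. Qed.

Theorem theorem1p2 (R : realType) (p q : nat -> R) (r : R)
    (hpq : forall n : nat, 0 <= q n /\ q n <= p n /\ p n <= 1)
    (hp : p n / (ln n%:R / n%:R) @[n --> \oo] --> +oo)
    (hr : \forall n \near \oo, q n / p n = r) :
  (1 / 7 < r ->
    forall kappa : R, 0 < kappa ->
    exists C C' K : R, [/\ 0 < C, 0 < C', 0 < K &
      whp p q (fun (n : nat) (E : {set {set vertex n}}) =>
        forall A : {set vertex n}, imbalanced kappa A ->
          Tcons_prob_ge E A
            (fun T : \bar R =>
               (T <= (C * (ln (ln n%:R) + ln n%:R / ln (n%:R * p n)))%:E)%E)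
            (1 - K * n%:R `^ (- C')))]) /\
  (r < 1 / 7 ->
    exists kappa C C' K : R, [/\ 0 < kappa, 0 < C, 0 < C', 0 < K &
      whp p q (fun (n : nat) (E : {set {set vertex n}}) =>
        exists2 A : {set vertex n}, imbalanced kappa A &
          Tcons_prob_ge E A
            (fun T : \bar R => ((expR (C * n%:R))%:E <= T)%E)
            (1 - K * n%:R `^ (- C')))]).
Proof.
split; last exact: slow_consensus hpq hp hr.
by move=> r7 kappa; exact: fast_consensus hpq hp hr r7.
Qed.
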